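(* Let $\delta\in\left]0,2/e\right]$, $\bar\beta>0$, and set $\beta=\bar\beta/\sqrt{\log(2/\delta)}$. Let $\gamma,\varepsilon>0$, $p>-1/2$, $L_\varepsilon=(1+\varepsilon)L$, and for $k\in\mathbb{N}$ let $$w_k=k^p,\qquad\gamma_k=\frac{\gamma}{\sqrt k},\qquad\lambda_k=\max\{\beta\sqrt k,(1+\varepsilon)L\}.$$ Let $(\bar x_k)_{k\in\mathbb{N}}$ be generated by the Clipped Stochastic subGradient Method (C-SsGM) with these parameters. Then, for every $k\ge(L_\varepsilon/\beta)^{\max\{\frac{2}{2p+1},2\}}$ if $p\ne0$, and every $k\ge(L_\varepsilon/\beta)^4$ if $p=0$, with probability at least $1-\delta$ we have \begin{align*} f(\bar{x}_k)- \min_X f &\leq \frac{\max\{p+1,1\}}{\sqrt{k}} \bigg[ \frac{D^2}{2 \gamma} + \gamma\bigg( \frac 2 3 \bar{\beta}^2 + \frac{a_p\bar{\beta}}{\sqrt{2}} \sqrt{\frac{\sigma^2}{m}+L^2} + \frac{\sigma^2/m + L^2}{2\min\{p+ 1/2,1\}} \bigg) \\ &\quad + D\bigg(\frac 4 3 \bar{\beta} + \Big(1+ \frac 1 \varepsilon\Big) \bigg( \frac{1}{\min\{2p+ 1,1\}}\frac{4 \sigma}{\sqrt{2 m}} + \frac{1}{\min\{p+ 1/2,1\}}\frac{\sigma^2}{m\bar{\beta}} \bigg) \bigg)\sqrt{\log \frac 2 \delta} \bigg], \end{align*} where $$a_p=\begin{cases}\sqrt{2/\min\{2p,1\}}&\text{if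 }p>0\\ 2&\text{if }p=0\\ \sqrt{1-\frac1{2p}}+\sqrt{\frac{1}{\min\{2p+1,1\}}}&\text{if }-1/2<p<0.\end{cases}$$ Moreover, in the finite-horizon setting, i.e., for fixed $k\in\mathbb{N}$ larger than $(L_\varepsilon/\beta)^2$, $p\ge0$, and the algorithm run with $\gamma_i=\gamma/\sqrt k$, $\lambda_i=\max\{\beta\sqrt i,(1+\varepsilon)L\}$, $w_i=i^p$ for $1\le i\le k$, with probability at least $1-\delta$ we have \begin{align*} f(\bar{x}_k)- \min_X f &\leq \frac{\max\{p+1,1\}}{\sqrt{k}} \bigg[ \frac{D^2}{2 \gamma} + \gamma\bigg( \frac 2 3 \bar{\beta}^2 + \bar{\beta} \sqrt{\frac{\sigma^2}{m}+L^2} + \frac{\sigma^2/m + L^2}{2} \bigg) \\ &\quad + D\bigg(\frac 4 3 \bar{\beta} + \Big(1+ \frac 1 \varepsilon\Big) \bigg( \frac{1}{\min\{2p+ 1,1\}}\frac{4 \sigma}{\sqrt{2 m}} + \frac{1}{\min\{p+ 1/2,1\}}\frac{\sigma^2}{m\bar{\beta}} \bigg) \bigg)\sqrt{\log \frac 2 \delta} \bigg]. \end{align*}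
   Context: $\mathbb{N}=\{1,2,\dots\}$, $\mathbb{R}_{++}=\left]0,+\infty\right[$, $\log$ is the natural logarithm. Setting: $H$ is a real Hilbert space with scalar product $\langle\cdot,\cdot\rangle$ and norm $\|\cdot\|$; $X\subset H$ is a nonempty closed convex bounded set with diameter $D\ge 0$, and $P_X$ is the orthogonal projection onto $X$; $f\colon H\to\mathbb{R}$ is convex and Lipschitz continuous with constant $L>0$; $\partial f(x)=\{u\in H : f(y)\ge f(x)+\langle y-x,u\rangle \ \forall y\in H\}$. $\xi$ is a random variable and $\hat u(x,\xi)\in H$ is a stochastic subgradient: for all $x\in X$, $\mathbb{E}[\hat u(x,\xi)]\in\partial f(x)$ and $\mathbb{E}[\|\hat u(x,\xi)-\mathbb{E}[\hat u(x,\xi)]\|^2]\le\sigma^2$. Clipping: for $u\in H$ and $\lambda>0$, $\mathrm{CLIP}(u,\lambda)=u$ if $\|u\|\le\lambda$ and $\mathrm{CLIP}(u,\lambda)=\frac{\lambda}{\|u\|}u$ if $\|u\|>\lambda$. Clipped Stochastic subGradient Method (C-SsGM): given stepsizes $(\gamma_k)_{k\in\mathbb{N}}$, weights $(w_k)_{k\in\mathbb{N}}$ and clipping levels $(\lambda_k)_{k\in\mathbb{N}}$, all in $\mathbb{R}_{++}$, a batch size $m\in\mathbb{N}$, $m\ge1$, and an initial point $x_1\in X$, for $k=1,2,\dots$: draw $\boldsymbol{\xi}^k=(\xi^k_j)_{1\le j\le m}$, $m$ independent copies of $\xi$ (also independent of the batches drawn at the previous iterations); set $\bar u_k=\frac1m\sum_{j=1}^m\hat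 u(x_k,\xi^k_j)$, $\tilde u_k=\mathrm{CLIP}(\bar u_k,\lambda_k)$, $x_{k+1}=P_X(x_k-\gamma_k\tilde u_k)$. The averages are $\bar x_k=\big(\sum_{i=1}^k w_i\big)^{-1}\sum_{i=1}^k w_ix_i$. *)

(* Defs.v *)
From HB Require Import structures.
From mathcomp Require Import all_boot all_order all_algebra.
From mathcomp Require Import finmap.
From mathcomp Require Import all_classical all_reals all_analysis.

Set Implicit Arguments.
Unset Strict Implicit.
Unset Printing Implicit Defensive.

Import Order.TTheory GRing.Theory Num.Theory.
Import numFieldNormedType.Exports.

Local Open Scope classical_set_scope.
Local Open Scope ring_scope.

(* A real Hilbert space is a complete normed module [H] over [R : realType]
   together with a scalar product [dot : {dot H for idfun}] such that
   [dot x x = `|x| ^+ 2] for all [x]. *)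

Section Hilbert.
Context {R : realType} {H : completeNormedModType R}.
Implicit Types (X : set H) (f : H -> R).

Definition diameter X : R := sup [set `|x - y| | x in X & y in X].

(* The point of X closest to x; the default value 0 is irrelevant when X is
   nonempty, closed and convex. *)
Definition projection X (x : H) : H :=
  xget 0 [set q | X q /\ forall y, X y -> `|x - q| <= `|x - y|].

(* The minimum of f over X; when f is convex and continuous and X is nonempty,
   closed, convex and bounded, the minimum is attained by weak compactness, so
   that the default value 0 is irrelevant. *)
Definition min_value X f : R :=
  xget 0 [set r | (f @` X) r /\ forall y, X y -> r <= f y].

Definition subdifferential (dot : {dot H for idfun}) f (x : H) : set H :=
  [set u | forall y, f x + dot (y - x) u <= f y].

Definition clip (u : H) (lambda : R) : H :=
  if `|u| <= lambda then u else (lambda / `|u|) *: u.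

Definition separable_set (A : set H) : Prop :=
  exists2 C : set H, countable C & A `<=` closure C.

(* H is not assumed to be separable, so measurability of H-valued maps is
   strong (Bochner) measurability: f is, on D, a pointwise limit of measurable
   maps with finitely many values. When H is separable and D is measurable,
   this is Borel measurability of f on D. *)
Definition strongly_measurable d (T : measurableType d) (D : set T)
    (f : T -> H) : Prop :=
  exists s : nat -> T -> H,
    (forall n, finite_set (range (s n)) /\
               forall v, measurable (s n @^-1` [set v])) /\
    (forall t, D t -> s ^~ t @ \oo --> f t).

(* Joint measurability of u on X * Z, for the Borel sigma-algebra of H, along
   separable subsets of X; if H is separable it is enough to take A = X. *)
Definition jointly_measurable d (Z : measurableType d) X
    (u : H -> Z -> H) : Prop :=
  forall A : set H, A `<=` X -> separable_set A ->
    strongly_measurable (T := (g_sigma_algebraType (@open H) * Z)%type)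
      (A `*` [set: Z]) (fun xz => u xz.1 xz.2).

End Hilbert.

Section Probability.
Context {R : realType} {H : completeNormedModType R}.
Context d (Omega : measurableType d) (P : probability Omega R).

(* v is the expectation of the H-valued random vector U. *)
Definition is_expectation (dot : {dot H for idfun}) (U : Omega -> H)
    (v : H) : Prop :=
  [/\ strongly_measurable [set: Omega] U,
      P.-integrable [set: Omega] (fun w => (`|U w|)%:E) &
      forall y : H, ('E_P[fun w => dot (U w) y] = (dot v y)%:E)%E].

Definition stochastic_subgradient d' (Z : measurableType d')
    (dot : {dot H for idfun}) (X : set H) (f : H -> R) (u : H -> Z -> H)
    (xi : {RV P >-> Z}) (sigma : R) : Prop :=
  jointly_measurable X u /\
  forall x, X x -> exists v : H,
    [/\ is_expectation dot (fun w => u x (xi w)) v,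
        subdifferential dot f x v &
        ('E_P[fun w => (`|u x (xi w) - v| ^+ 2)%R] <= (sigma ^+ 2)%:E)%E].

Definition mutually_independent d' (Z : measurableType d') (I : choiceType)
    (D : set I) (Y : I -> {RV P >-> Z}) : Prop :=
  forall (J : {fset I}) (B : I -> set Z),
    [set` J] `<=` D -> (forall i, measurable (B i)) ->
    (P (\bigcap_(i in [set` J]) (Y i @^-1` B i)) =
     \prod_(i <- J) P (Y i @^-1` B i))%E.

(* The variables xi_ k j with k >= 1 are independent copies of xi; the batch
   xi_ 0 is never used. *)
Definition iid_copies d' (Z : measurableType d') (m : nat)
    (xi : {RV P >-> Z}) (xi_ : nat -> 'I_m -> {RV P >-> Z}) : Prop :=
  mutually_independent [set kj : nat * 'I_m | (0 < kj.1)%N]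
    (fun kj => xi_ kj.1 kj.2) /\
  forall k j, (0 < k)%N -> forall B : set Z, measurable B ->
    distribution P (xi_ k j) B = distribution P xi B.

End Probability.

Section Algorithm.
Context {R : realType} {H : completeNormedModType R}.
Context {Omega Z : Type} (m : nat).

(* Sequences are indexed from 1: the iterate number k >= 1 is [cssgm _ k], and
   the values at index 0 play no role. *)
Fixpoint cssgm (X : set H) (u : H -> Z -> H) (gam lam : nat -> R) (x1 : H)
    (xi_ : nat -> 'I_m -> Omega -> Z) (k : nat) (w : Omega) : H :=
  if k is k'.+1 then
    if k' is 0%N then x1 else
      let x := cssgm X u gam lam x1 xi_ k' w in
      let ubar := m%:R^-1 *: \sum_(j < m) u x (xi_ k' j w) in
      projection X (x - gam k' *: clip ubar (lam k'))
  else x1.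

Definition weighted_average (wt : nat -> R) (x : nat -> Omega -> H) (k : nat)
    (w : Omega) : H :=
  (\sum_(1 <= i < k.+1) wt i)^-1 *: \sum_(1 <= i < k.+1) wt i *: x i w.

End Algorithm.

Definition a_coef {R : realType} (p : R) : R :=
  if 0 < p then Num.sqrt (2 / Num.min (2 * p) 1)
  else if p == 0 then 2
  else Num.sqrt (1 - 1 / (2 * p)) + Num.sqrt (1 / Num.min (2 * p + 1) 1).

(* Main.v *)
(* With [r_k] the minimum of [gamma_k |v_k|^2 / 2] and [D |v_k|], where [v_k] is
   the clipped batch mean, the projection step gives
   [gamma_k <v_k, x_k - x*> <= (|x_k - x*|^2 - |x_{k+1} - x*|^2) / 2
                               + gamma_k r_k].
   Summing with the weights [w_k] telescopes, since [w_k / gamma_k] is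
   nondecreasing, and bounds the weighted sum of the gaps [f x_k - f x*] by a
   deterministic term plus the two random sums of
   [w_k (f x_k - f x* - <v_k, x_k - x*>)] and of [w_k r_k].  Conditionally on
   the past, the exponentials of their terms are dominated pointwise by affine
   functions of [u_k - E u_k] and [|u_k - E u_k|^2], with [u_k] the unclipped
   batch mean, whose expectations are known; hence each sum satisfies a
   Bernstein inequality outside an event of probability [delta / 2].  Its scale
   is at most [2 D max_(i <= k) w_i lambda_i <= 2 D beta k^(p + 1/2)]; this and
   the power sums in the variances are where the thresholds on [k] enter. *)

Require Import Defs.
From HB Require Import structures.
From mathcomp Require Import all_boot all_order all_algebra.
From mathcomp Require Import finmap.
From mathcomp Require Import ring lra.
From mathcomp Require Import all_classical all_reals all_analysis.
From mathcomp Require Import measurable_realfun.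

Set Implicit Arguments.
Unset Strict Implicit.
Unset Printing Implicit Defensive.

Import Order.TTheory GRing.Theory Num.Theory.
Import numFieldNormedType.Exports.

Local Open Scope classical_set_scope.
Local Open Scope ring_scope.

(** Only two moments of the stochastic subgradients are available, so exponential moments must come
    from clipping. Dominating the exponentials pointwise, before integrating, avoids centering the
    clipped means by their conditional expectations: the linear term has mean zero and the quadratic
    one costs [sigma ^+ 2 / m%:R]. The clipping bias is also absorbed by the quadratic term, because
    a batch mean that gets clipped is at distance of order [lambda_k] from the subgradient; the
    margin [epsilon] ensures this and produces the factor [1 + 1 / epsilon]. The clipping level
    balances two effects. The bias contributes the sum of w_i / lambda_i, of order k^(p + 1/2) /
    beta, and the scale term of Bernstein's inequality is of order beta k^(p + 1/2) log(2/delta). As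
    beta is [betabar] over the square root of this logarithm, both are of order k^(p + 1/2) times
    that root. Dividing by the sum of the weights, of order k^(p + 1), leaves the rate 1 / sqrt
    k. *)

(** * Scalar inequalities *)

(* The difference of the two sides has second derivative
   [2 * (1 - (1 - y) * expR y) >= 0] and vanishes to first order at 0. *)
Lemma expR_pade (R : realType) (y : R) :
  (6 - 2 * y) * expR y <= 6 + 4 * y + y ^+ 2.
Proof.
pose g (x : R) := 4 + 2 * x - (4 - 2 * x) * expR x.
pose f (x : R) := 6 + 4 * x + x ^+ 2 - (6 - 2 * x) * expR x.
have dg (x : R) : is_derive x (1:R) g (2 - (2 - 2 * x) * expR x).
  by apply: is_derive_eq; rewrite /GRing.scale /=; ring.
have df (x : R) : is_derive x (1:R) f (g x).
  by apply: is_derive_eq; rewrite /GRing.scale /= /g; ring.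
have cg : continuous g.
  by move=> x; apply/differentiable_continuous/derivable1_diffP; case: (dg x).
have cf : continuous f.
  by move=> x; apply/differentiable_continuous/derivable1_diffP; case: (df x).
have dg_ge0 (x : R) : 0 <= 2 - (2 - 2 * x) * expR x.
  have := expR_ge1Dx (- x); rewrite expRN => h.
  have e0 := expR_gt0 x.
  have : (1 - x) * expR x <= 1.
    by rewrite -ler_pdivlMr // mul1r.
  by move=> h'; lra.
have g0 : g 0 = 0 by rewrite /g expR0; ring.
have f0 : f 0 = 0 by rewrite /f expR0; ring.
have g_mono a b : a <= b -> g a <= g b.
  move=> ab; apply: (@ger0_derive1_ndecr _ g a b) => // [x _|].
  - by rewrite derive1E derive_val.
  - exact: continuous_subspaceT.
rewrite -subr_ge0 -[X in _ <= X]/(f y) -f0.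
have [y0|y0] := leP 0 y.
  apply: (@ger0_derive1_ndecr _ f 0 y) => // [x|].
  - rewrite in_itv /= => /andP[x0 _]; rewrite derive1E derive_val -g0.
    exact/g_mono/ltW.
  - exact: continuous_subspaceT.
apply: (@ler0_derive1_nincr _ f y 0) => // [x||].
- rewrite in_itv /= => /andP[_ x0]; rewrite derive1E derive_val -g0.
  exact/g_mono/ltW.
- exact: continuous_subspaceT.
- exact: ltW.
Qed.

(** Division of [expR_pade] by [6 - 2 * y] gives the bound with [y] in place of [c], and that bound
    increases with [c]. Only an upper bound on [y] enters, so one-sided control of the random terms
    will do. *)
Lemma expR_le_quadratic (R : realType) (y c : R) : y <= c -> c < 3 ->
  expR y <= 1 + y + y ^+ 2 / (2 * (1 - c / 3)).
Proof.
move=> yc c3; have h := expR_pade y.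
have y3 : 0 < 6 - 2 * y by lra.
rewrite mulrC -ler_pdivlMr // in h; apply: (le_trans h).
have -> : (6 + 4 * y + y ^+ 2) / (6 - 2 * y) =
    1 + y + y ^+ 2 / (2 * (1 - y / 3)) by field; lra.
rewrite lerD2l ler_wpM2l ?sqr_ge0// lef_pV2 ?posrE; lra.
Qed.

(** Weighted arithmetic-geometric inequality for [a] and 1 with weights [r] and [1 - r]:
    [ln x <= x - 1], taken at [a / c] and [c^-1] with these weights, has right-hand sides adding up
    to 0. *)
Lemma powR_le_affine (R : realType) (a r : R) : 0 < a -> 0 <= r <= 1 ->
  a `^ r <= 1 + r * (a - 1).
Proof.
move=> a0 /andP[r0 r1].
have [->|rn0] := eqVneq r 0; first by rewrite powRr0 mul0r addr0.
set c := 1 + r * (a - 1).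
have c0 : 0 < c.
  have [e|?] := eqVneq r 1; first by rewrite /c e; lra.
  have -> : c = (1 - r) + r * a by rewrite /c; ring.
  have : r < 1 by rewrite lt_neqAle; apply/andP.
  by move=> ?; apply: ltr_pwDl; [lra|rewrite mulr_ge0// ltW].
rewrite -(@ler_ln R) ?posrE ?powR_gt0// ln_powR.
have ln_le (x : R) : 0 < x -> ln x <= x - 1.
  by move=> x0; have -> : x = 1 + (x - 1) by [ring]; rewrite [leRHS]addrC addKr
    le_ln1Dx//; lra.
have h1 := ln_le (a / c) (divr_gt0 a0 c0).
have h2 := ln_le c^-1; rewrite invr_gt0 in h2; have {}h2 := h2 c0.
rewrite ln_div ?posrE// in h1; rewrite lnV ?posrE// in h2.
have h3 : r * (ln a - ln c) <= r * (a / c - 1) by rewrite ler_wpM2l.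
have h4 : (1 - r) * (- ln c) <= (1 - r) * (c^-1 - 1) by rewrite ler_wpM2l//;
  lra.
have e : r * (a / c - 1) + (1 - r) * (c^-1 - 1) = 0.
  have -> : r * (a / c - 1) + (1 - r) * (c^-1 - 1) = (1 + r * (a - 1)) / c - 1.
    by ring.
  by rewrite divff ?subrr// gt_eqF.
lra.
Qed.

(** One step of the comparison with the integral of x^q: the concave power [q + 1] lies below its
    tangent at 1, evaluated at the ratio n / (n + 1). *)
Lemma powRSn_ge (R : realType) (n : nat) (q : R) : -1 < q <= 0 ->
  n%:R `^ (q + 1) + (q + 1) * n.+1%:R `^ q <= n.+1%:R `^ (q + 1).
Proof.
move=> /andP[q1 q0].
have n0 : (0 : R) < n.+1%:R by rewrite ltr0n.
have [->|n_gt0] := posnP n.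
  rewrite powR0 ?add0r; last by lra.
  by rewrite !powR1 mulr1; lra.
have e : n.+1%:R `^ (q + 1) = n.+1%:R * n.+1%:R `^ q.
  by rewrite powRD ?(gt_eqF n0) ?implybT// powRr1 1?mulrC// ltW.
have a0 : 0 < n%:R / n.+1%:R :> R by rewrite divr_gt0 ?ltr0n.
have := @powR_le_affine R _ (q + 1) a0.
have -> : 0 <= q + 1 <= 1 by lra.
move=> /(_ isT) h.
have -> : n%:R `^ (q + 1) = (n%:R / n.+1%:R) `^ (q + 1) * n.+1%:R `^ (q + 1).
  by rewrite -powRM ?divr_ge0 ?ler0n// divfK// gt_eqF.
apply: (@le_trans _ _ ((1 + (q + 1) * (n%:R / n.+1%:R - 1)) * n.+1%:R `^ (q + 1)
    + (q + 1) * n.+1%:R `^ q)).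
  by rewrite lerD2r ler_wpM2r// powR_ge0.
rewrite e le_eqVlt; apply/orP; left; apply/eqP.
rewrite -[n.+1]addn1 natrD; field.
by rewrite natr1 gt_eqF.
Qed.

Lemma powRSn_le (R : realType) (n : nat) (q : R) : 0 <= q ->
  n.+1%:R `^ (q + 1) <= n%:R `^ (q + 1) + (q + 1) * n.+1%:R `^ q.
Proof.
move=> q0.
have n0 : (0 : R) < n.+1%:R by rewrite ltr0n.
have [->|n_gt0] := posnP n.
  rewrite powR0 ?add0r; last by lra.
  by rewrite !powR1 mulr1; lra.
have e : n.+1%:R `^ (q + 1) = n.+1%:R * n.+1%:R `^ q.
  by rewrite powRD ?(gt_eqF n0) ?implybT// powRr1 1?mulrC// ltW.
(* Here [q + 1 >= 1], so the affine bound is applied to the inverse exponent, at the power [x] of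
   the ratio. *)
pose x : R := (n%:R / n.+1%:R) `^ (q + 1).
have x0 : 0 < x by rewrite powR_gt0// divr_gt0 ?ltr0n.
have := @powR_le_affine R x (q + 1)^-1 x0.
have -> : 0 <= (q + 1)^-1 <= 1 by rewrite invr_ge0 invf_le1; lra.
move=> /(_ isT).
rewrite -powRrM mulfV ?powRr1 ?divr_ge0 ?ler0n//; last by lra.
have -> : 1 + (q + 1)^-1 * (x - 1) = (q + x) / (q + 1) by field; lra.
rewrite ler_pdivlMr; last by lra.
have -> : n%:R `^ (q + 1) = x * n.+1%:R `^ (q + 1).
  by rewrite /x -powRM ?divr_ge0 ?ler0n// divfK//; lra.
rewrite e => h.
have {}h : n%:R * (q + 1) <= (q + x) * n.+1%:R.
  by rewrite -ler_pdivrMr// mulrAC.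
rewrite !mulrA -mulrDl ler_wpM2r ?powR_ge0//.
rewrite -natr1 in h *; lra.
Qed.

(** For [q <= 0] the steps [powRSn_ge] telescope; for [q > 0] the crude bound by [k] times the
    largest term is kept, whence the 1 in the minimum. *)
Lemma sum_powR_le (R : realType) (q : R) (k : nat) : -1 < q ->
  \sum_(1 <= i < k.+1) i%:R `^ q <= k%:R `^ (q + 1) / Num.min (q + 1) 1.
Proof.
move=> q1; have [q0|q0] := leP q 0.
  rewrite min_l; last by lra.
  rewrite ler_pdivlMr; last by lra.
  elim: k => [|k IH]; first by rewrite big_geq// mul0r powR_ge0.
  rewrite big_nat_recr//= mulrDl.
  have := @powRSn_ge R k q; rewrite q1 q0 => /(_ isT).
  by apply: le_trans; rewrite lerD// mulrC.
rewrite min_r ?divr1; last by lra.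
elim: k => [|k IH]; first by rewrite big_geq// powR_ge0.
rewrite big_nat_recr//=; apply: (le_trans (lerD IH (lexx _))).
have e (j : nat) : j%:R `^ (q + 1) = j%:R * j%:R `^ q.
  by rewrite powRD ?powRr1 1?mulrC// gt_eqF//; lra.
rewrite !e; set B := k.+1%:R `^ q.
have -> : k.+1%:R * B = k%:R * B + B by rewrite -natr1 mulrDl mul1r.
rewrite lerD2r ler_wpM2l//.
by rewrite ge0_ler_powR ?nnegrE ?ler0n ?ler_nat// ltW.
Qed.

Lemma sum_powR_ge (R : realType) (q : R) (k : nat) : -1 < q ->
  k%:R `^ (q + 1) / Num.max (q + 1) 1 <= \sum_(1 <= i < k.+1) i%:R `^ q.
Proof.
move=> q1; have [q0|q0] := leP q 0.
  rewrite max_r ?divr1; last by lra.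
  have [->|k0] := posnP k; first by rewrite powR0 ?big_geq//; lra.
  have -> : k%:R `^ (q + 1) = \sum_(1 <= i < k.+1) k%:R `^ q.
    rewrite sumr_const_nat subn1 /= -[RHS]mulr_natr powRD ?powRr1 ?ler0n//.
    by rewrite pnatr_eq0 -lt0n k0 implybT.
  rewrite ler_sum_nat// => i /andP[i1 ik].
  have i0 : (0 : R) < i%:R by rewrite ltr0n.
  have kp : (0 : R) < k%:R by rewrite ltr0n.
  rewrite -[q]opprK (powRN k%:R) (powRN i%:R) lef_pV2 ?posrE ?powR_gt0//.
  by rewrite ge0_ler_powR ?nnegrE ?ler0n ?ler_nat// oppr_ge0.
rewrite max_l; last by lra.
rewrite ler_pdivrMr; last by lra.
elim: k => [|k IH]; first by rewrite big_geq// mul0r powR0//; lra.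
rewrite big_nat_recr//= mulrDl.
by rewrite (le_trans (powRSn_le _ (ltW q0)))// lerD// mulrC.
Qed.

Lemma ln_ge_1subV (R : realType) (x : R) : 0 < x -> 1 - x^-1 <= ln x.
Proof.
move=> x0; rewrite -[x in ln x]invrK lnV ?posrE ?invr_gt0//.
have y0 : 0 < x^-1 by rewrite invr_gt0.
have : ln (1 + (x^-1 - 1)) <= x^-1 - 1 by apply: le_ln1Dx; lra.
by rewrite addrC subrK; lra.
Qed.

(** Integral test: the bound is 1 plus the integral of x^(s - 1) from 1 to infinity. The induction
    carries the integral up to [k], since the limit leaves no room for the next term. *)
Lemma sum_powR_lt_cvg (R : realType) (s : R) (k : nat) : s < 0 ->
  \sum_(1 <= i < k.+1) i%:R `^ (s - 1) <= 1 - 1 / s.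
Proof.
move=> s0.
suff h : (0 < k)%N ->
    \sum_(1 <= i < k.+1) i%:R `^ (s - 1) <= 1 + (1 - k%:R `^ s) / (- s).
  have [->|k0] := posnP k.
    by rewrite big_geq// div1r; have : s^-1 < 0 by [rewrite invr_lt0]; lra.
  apply: (le_trans (h k0)); rewrite lerD2l invrN mulrN lerN2 -subr_ge0.
  rewrite -mulrBl; have : 0 <= k%:R `^ s by exact: powR_ge0.
  by move=> ?; rewrite mulr_le0// ?invr_le0; lra.
elim: k => [//|[|k] IH] _; first by rewrite big_nat1 !powR1 subrr mul0r addr0.
rewrite big_nat_recr//=; apply: (le_trans (lerD (IH isT) (lexx _))).
rewrite -addrA lerD2l.
set a : R := k.+1%:R; set b : R := k.+2%:R.
have a0 : 0 < a by rewrite ltr0n.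
have b0 : 0 < b by rewrite ltr0n.
have eb : b `^ (s - 1) = b `^ s / b.
  by rewrite powRD ?(gt_eqF b0) ?implybT// powR_inv1// ltW.
(* Since [b = a + 1], (a / b)^s = exp(- s ln(b / a)) is at least 1 - s ln(b / a), hence at least 1 -
   s / b. *)
have : b `^ s * (1 - s / b) <= a `^ s.
  have -> : a `^ s = b `^ s * expR (- s * ln (b / a)).
    rewrite ln_div ?posrE// /powR !gt_eqF// -expRD; congr expR; ring.
  rewrite ler_wpM2l ?powR_ge0//.
  apply: (le_trans _ (expR_ge1Dx _)); rewrite lerD2l mulNr lerN2.
  rewrite ler_nM2l//; apply: (le_trans _ (@ln_ge_1subV _ _ (divr_gt0 b0 a0))).
  rewrite invf_div le_eqVlt; apply/orP; left; apply/eqP.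
  have eb1 : b = a + 1 by rewrite /b -natr1.
  by rewrite eb1; field; rewrite gt_eqF// ltr_pwDl ?ltW.
rewrite eb; set A := a `^ s; set B := b `^ s => h.
rewrite -subr_ge0.
have -> : (1 - B) / (- s) - ((1 - A) / (- s) + B / b) =
   (A - B * (1 - s / b)) / (- s).
  by field; rewrite lt_eqF// gt_eqF.
by rewrite divr_ge0 ?subr_ge0// oppr_ge0 ltW.
Qed.

Lemma sum_inv_le (R : realType) (k : nat) : (0 < k)%N ->
  \sum_(1 <= i < k.+1) (i%:R : R)^-1 <= 1 + ln k%:R.
Proof.
elim: k => [//|[|k] IH] _; first by rewrite big_nat1 invr1 ln1 addr0.
rewrite big_nat_recr//=; apply: (le_trans (lerD (IH isT) (lexx _))).
set a : R := k.+1%:R; set b : R := k.+2%:R.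
have a0 : 0 < a by rewrite ltr0n.
have b0 : 0 < b by rewrite ltr0n.
have := @ln_ge_1subV _ _ (divr_gt0 b0 a0); rewrite ln_div ?posrE// invf_div.
have -> : 1 - a / b = b^-1.
  have eb : b = a + 1 by rewrite /b -natr1.
  by rewrite eb; field; rewrite gt_eqF// ltr_pwDl ?ltW.
by rewrite -addrA lerD2l -lerBrDl.
Qed.

(** * Inner product, projection and clipping *)

Section InnerProduct.
Context {R : realType} {H : completeNormedModType R} (dot : {dot H for idfun}).
Hypothesis dot_norm : forall x : H, dot x x = `|x| ^+ 2.
Implicit Types (x y z : H) (X : set H).

Lemma dotC x y : dot x y = dot y x.
Proof. by rewrite hermC expr0 mul1r. Qed.

Lemma dotDl x y z : dot (x + y) z = dot x z + dot y z.
Proof. exact: linearDl. Qed.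

Lemma dotDr x y z : dot z (x + y) = dot z x + dot z y.
Proof. exact: linearDr. Qed.

Lemma dotNl x z : dot (- x) z = - dot x z.
Proof. exact: linearNl. Qed.

Lemma dotNr x z : dot z (- x) = - dot z x.
Proof. exact: linearNr. Qed.

Lemma dotZl (a : R) x z : dot (a *: x) z = a * dot x z.
Proof. by rewrite linearZl_LR. Qed.

Lemma dotZr (a : R) x z : dot z (a *: x) = a * dot z x.
Proof. by rewrite dotC dotZl dotC. Qed.

Definition dotE := (dotDl, dotDr, dotNl, dotNr, dotZl, dotZr).

Lemma normD_sqr x y : `|x + y| ^+ 2 = `|x| ^+ 2 + 2 * dot x y + `|y| ^+ 2.
Proof. by rewrite -!dot_norm !dotE (dotC y x); ring. Qed.

Lemma normB_sqr x y : `|x - y| ^+ 2 = `|x| ^+ 2 - 2 * dot x y + `|y| ^+ 2.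
Proof. by rewrite normD_sqr normrN dotNr mulrN. Qed.

Lemma dot_le_norm x y : dot x y <= `|x| * `|y|.
Proof.
have [->|x0] := eqVneq x 0; first by rewrite linear0l normr0 mul0r.
have [->|y0] := eqVneq y 0; first by rewrite linear0r normr0 mulr0.
have nx : 0 < `|x| by rewrite normr_gt0.
have ny : 0 < `|y| by rewrite normr_gt0.
have : 0 <= `| `|y| *: x - `|x| *: y| ^+ 2 by exact: sqr_ge0.
rewrite normB_sqr !normrZ !dotE !normr_id => h.
have {}h : 0 <= (2 * (`|x| * `|y|)) * (`|x| * `|y| - dot x y).
  by apply: (le_trans h); rewrite le_eqVlt; apply/orP; left; apply/eqP; ring.
by move: h; rewrite pmulr_rge0 ?subr_ge0// !mulr_gt0.
Qed.

Lemma abs_dot_le_norm x y : `|dot x y| <= `|x| * `|y|.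
Proof.
rewrite ler_norml dot_le_norm andbT.
by rewrite lerNl -dotNl (le_trans (dot_le_norm _ _))// normrN.
Qed.

Lemma cvg_dot (T : Type) (F : set_system T) (FF : Filter F) (a b : T -> H) x y :
  a @ F --> x -> b @ F --> y -> (fun t => dot (a t) (b t)) @ F --> dot x y.
Proof.
move=> ax bx.
(* Polarization reduces the joint continuity of [dot] to continuity of the norm. *)
have e u v : dot u v = (`|u + v| * `|u + v| - `|u| * `|u| - `|v| * `|v|) / 2.
  by rewrite -!expr2 normD_sqr; field.
have -> : (fun t => dot (a t) (b t)) = (fun t => (`|a t + b t| * `|a t + b t|
    - `|a t| * `|a t| - `|b t| * `|b t|) / 2) by apply/funext => t; rewrite e.
rewrite e; apply: cvgMr_tmp; apply: cvgB; first apply: cvgB.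
- by apply: cvgM; apply: cvg_norm; apply: cvgD.
- by apply: cvgM; apply: cvg_norm.
- by apply: cvgM; apply: cvg_norm.
Qed.

Lemma parallelogram x y :
  `|x - y| ^+ 2 = 2 * `|x| ^+ 2 + 2 * `|y| ^+ 2 - 4 * `|2^-1 *: (x + y)| ^+ 2.
Proof.
by rewrite normB_sqr normrZ exprMn normD_sqr ger0_norm ?invr_ge0//; field.
Qed.


Lemma convex_set_segment X x y (t : R) : convex_set X -> X x -> X y ->
  0 <= t <= 1 -> X (t *: x + (1 - t) *: y).
Proof.
move=> cX Xx Xy /andP[t0 t1].
have := cX x y (Itv01 t0 t1); rewrite !inE => /(_ Xx Xy).
exact.
Qed.

Lemma convex_set_midpoint X x y : convex_set X -> X x -> X y ->
  X (2^-1 *: (x + y)).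
Proof.
move=> cX Xx Xy; have := convex_set_segment (t := 2^-1) cX Xx Xy.
have -> : (0 <= 2^-1 :> R) && (2^-1 <= 1 :> R) by lra.
move=> /(_ isT); have -> : 1 - 2^-1 = 2^-1 :> R by field.
by rewrite scalerDr.
Qed.

(* The minimal-norm approximate minimizers form a Cauchy sequence, by the
   parallelogram law: no weak compactness is needed. *)
Lemma convex_attains_min X (g : H -> R) (B : R) : X !=set0 -> closed X ->
    convex_set X -> bounded_set X -> continuous g ->
    (forall x y, X x -> X y -> g (2^-1 *: (x + y)) <= (g x + g y) / 2) ->
    (forall x, X x -> B <= g x) ->
  exists2 q, X q & forall x, X x -> g q <= g x.
Proof.
move=> [x0 Xx0] clX cX bX cg midg gB.
pose mu := inf (g @` X).
have lbg : has_lbound (g @` X) by exists B => _ [x Xx <-]; exact: gB.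
have mu_le x : X x -> mu <= g x by move=> Xx; apply: ge_inf => //; exists x.
pose e (n : nat) : R := n.+1%:R^-1.
have e0 n : 0 < e n by rewrite invr_gt0 ltr0n.
have e_mono m n : (m <= n)%N -> e n <= e m.
  by move=> mn; rewrite lef_pV2 ?posrE ?ltr0n// ler_nat.
pose C n := [set x | X x /\ g x <= mu + e n].
have C0 n : C n !=set0.
  have [] := @inf_adherent _ (g @` X) (e n) (e0 n).
    by split=> //; exists (g x0); exists x0.
  by move=> _ [x Xx <-] h; exists x; split => //; exact: ltW.
pose N n := [set `|x| | x in C n].
have lbN n : has_lbound (N n) by exists 0 => _ [x _ <-].
have N0 n : N n !=set0 by have [x Cx] := C0 n; exists `|x|; exists x.
pose d n := inf (N n).
have d_le n x : C n x -> d n <= `|x|.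
  by move=> Cx; apply: ge_inf => //; exists x.
have d_ge0 n : 0 <= d n by apply: lb_le_inf => // _ [x _ <-].
have CS m n : (m <= n)%N -> C n `<=` C m.
  move=> mn x [Xx h]; split=> //; apply: (le_trans h).
  by rewrite lerD2l e_mono.
have /choice[z zP] n : exists z, C n z /\ `|z| <= d n + e n.
  have [] := @inf_adherent _ (N n) (e n) (e0 n); first by split.
  by move=> _ [x Cx <-] h; exists x; split => //; exact: ltW.
have d_mono : {homo d : m n / (m <= n)%N >-> m <= n}.
  move=> m n mn; apply: lb_le_inf => // _ [x Cx <-].
  by apply: d_le; exact: CS Cx.
have [M XM] : exists M, forall x, X x -> `|x| <= M.
  have [M [_ hM]] := bX; exists (M + 1) => x Xx; apply: hM => //; lra.
have ubd : has_ubound (range d).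
  exists M => _ [n _ <-]; have [x Cx] := C0 n.
  by apply: (le_trans (d_le _ _ Cx)); apply: XM; case: Cx.
have cd := nondecreasing_is_cvgn d_mono ubd.
pose l := limn d.
have d_lel n : d n <= l by exact: nondecreasing_cvgn_le.
(* The midpoint of [z n] and [z m] stays in [C n], so its norm is at least [d n]; both norms are at
   most [l + e n], and the parallelogram law bounds the distance by a null sequence. *)
have zz n m : (n <= m)%N -> `|z n - z m| ^+ 2 <= 4 * (l + e n) ^+ 2 - 4 * d n
  ^+ 2.
  move=> nm; rewrite (parallelogram).
  have [[Xn gn] zn] := zP n; have [Cm zm] := zP m.
  have [Xm gm] := CS _ _ nm _ Cm.
  have Cmid : C n (2^-1 *: (z n + z m)).
    split; first exact: convex_set_midpoint.
    by apply: (le_trans (midg _ _ Xn Xm)); lra.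
  have h1 := d_le _ _ Cmid.
  have h2 : `|z n| <= l + e n by apply: (le_trans zn); rewrite lerD2r.
  have h3 : `|z m| <= l + e n by apply: (le_trans zm); rewrite lerD ?e_mono.
  have sq (a b : R) : 0 <= a -> a <= b -> a ^+ 2 <= b ^+ 2.
    by move=> a0 ab; rewrite lerXn2r ?nnegrE// (le_trans a0).
  have := sq _ _ (d_ge0 _) h1; have := sq _ _ (normr_ge0 _) h2.
  have := sq _ _ (normr_ge0 _) h3.
  by move=> ? ? ?; lra.
have e_cvg : e @ \oo --> (0 : R) by exact: cvg_harmonic.
have rhs_cvg : (fun n => 4 * (l + e n) ^+ 2 - 4 * d n ^+ 2) @ \oo --> (0 : R).
  have -> : 0 = 4 * (l + 0) ^+ 2 - 4 * l ^+ 2 :> R by ring.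
  apply: cvgB; apply: cvgMl_tmp; rewrite ?expr2.
    under eq_fun do rewrite expr2.
    by apply: cvgM; apply: cvgD => //; exact: cvg_cst.
  under eq_fun do rewrite expr2.
  exact: cvgM.
have cz : cvg (z @ \oo).
  apply/cauchy_cvgP/cauchy_exP => eps eps0.
  have : \forall n \near \oo, 4 * (l + e n) ^+ 2 - 4 * d n ^+ 2 < eps ^+ 2.
    apply: cvgr_lt rhs_cvg _ _; exact: exprn_gt0.
  case=> n _ hn; exists (z n); exists n => // m /= nm.
  rewrite -ball_normE /=.
  have := le_lt_trans (zz _ _ nm) (hn n (leqnn n)).
  by rewrite ltr_pXn2r ?nnegrE// ltW.
pose q := lim (z @ \oo).
have Xq : X q.
  apply: (@closed_cvg nat H \oo _ z X clX _ q cz).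
  by apply: nearW => n; have [[]] := zP n.
exists q => // x Xx; apply: le_trans (mu_le _ Xx).
apply: (@ler_cvg_to nat \oo _ R (fun n => g (z n)) (fun n => mu + e n)).
- exact: (@continuous_cvg nat H R \oo _ z g q (cg q) cz).
- by rewrite -[X in _ --> X]addr0; apply: cvgD => //; exact: cvg_cst.
- by apply: nearW => n; have [[]] := zP n.
Qed.

Lemma lipschitz_cvg_continuous (V W : normedModType R) (g : V -> W) (K : R) :
  (forall x y : V, `|g x - g y| <= K * `|x - y|) -> continuous g.
Proof.
move=> gK x; apply/cvgrPdist_le => e e0.
near=> y; apply: (le_trans (gK _ _)).
have K0 : 0 < `|K| + 1 by rewrite ltr_pwDr.
apply: (@le_trans _ _ ((`|K| + 1) * `|x - y|)).
  by rewrite ler_wpM2r// (le_trans (ler_norm K))// lerDl.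
rewrite -ler_pdivlMl//; near: y; apply: cvgr_dist_le; first exact: cvg_id.
by rewrite mulr_gt0// invr_gt0.
Unshelve. all: by end_near. Qed.

Section Projection.
Variable X : set H.
Hypotheses (X0 : X !=set0) (clX : closed X) (cX : convex_set X)
  (bX : bounded_set X).

Lemma projection_spec x :
  X (projection X x) /\ forall y, X y -> `|x - projection X x| <= `|x - y|.
Proof.
have cg : continuous (fun y => `|x - y|).
  by move=> y; apply: cvg_norm; apply: cvgB; [exact: cvg_cst|exact: cvg_id].
have [||q Xq qmin] := @convex_attains_min X _ 0 X0 clX cX bX cg.
- move=> a b Xa Xb.
  have -> : x - 2^-1 *: (a + b) = 2^-1 *: ((x - a) + (x - b)).
    rewrite addrACA -opprD [in RHS]scalerBr; congr (_ - _).
    by rewrite scalerDr -scalerDl -(mul1r 2^-1) -splitr scale1r.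
  rewrite normrZ ger0_norm ?invr_ge0// mulrC ler_wpM2r ?invr_ge0//.
  exact: ler_normD.
- by move=> *.
by apply: (@xgetPex _ 0 [set q | X q /\ forall y, X y -> `|x - q| <= `|x - y|]);
  exists q.
Qed.

Lemma projection_in x : X (projection X x).
Proof. by case: (projection_spec x). Qed.

Lemma projection_obtuse x y : X y ->
  dot (x - projection X x) (y - projection X x) <= 0.
Proof.
move=> Xy; have [Xq qmin] := projection_spec x.
set q := projection X x in Xq qmin *; set d := dot _ _.
rewrite leNgt; apply/negP => d0.
set n := `|y - q| ^+ 2.
have n0 : 0 <= n by exact: sqr_ge0.
(* Moving from [q] towards [y] by the fraction [t] changes the squared distance to [x] by
   [t * (t * n - 2 * d)], negative once [t * n <= d]. The denominator [n + 1] covers [n = 0]. *)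
pose t := Num.min 1 (d / (n + 1)).
have t0 : 0 < t by rewrite lt_min ltr01 divr_gt0//; lra.
have t1 : t <= 1 by rewrite ge_min lexx.
have tn : t * n <= d.
  apply: (@le_trans _ _ (d / (n + 1) * n)).
    by rewrite ler_wpM2r// ge_min lexx orbT.
  by rewrite mulrAC ler_pdivrMr ?ler_wpM2l//; lra.
have Xt : X (t *: y + (1 - t) *: q).
  by apply: convex_set_segment => //; rewrite (ltW t0).
have := qmin _ Xt.
have -> : x - (t *: y + (1 - t) *: q) = (x - q) - t *: (y - q).
  rewrite scalerBl scale1r scalerBr addrCA opprD opprB.
  by rewrite addrA.
move=> h; have {h} : `|x - q| ^+ 2 <= `|x - q - t *: (y - q)| ^+ 2.
  by rewrite lerXn2r ?nnegrE.
rewrite [in leRHS]normB_sqr dotZr -/d normrZ exprMn -/n real_normK ?num_real//.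
move=> h; have : 0 <= t * (t * n - 2 * d) by lra.
by rewrite pmulr_rge0//; lra.
Qed.

Lemma projection_nonexpansive x y :
  `|projection X x - projection X y| <= `|x - y|.
Proof.
set p := projection X x; set q := projection X y.
have h1 : dot (x - p) (q - p) <= 0 by apply/projection_obtuse/projection_in.
have h2 : dot (y - q) (p - q) <= 0 by apply/projection_obtuse/projection_in.
have : `|p - q| ^+ 2 <= dot (x - y) (p - q).
  rewrite -dot_norm; move: h1 h2; rewrite !dotE => h1 h2.
  lra.
have [->|pq] := eqVneq p q; first by rewrite subrr normr0.
move=> /le_trans/(_ (dot_le_norm _ _)); rewrite expr2 ler_pM2r//.
by rewrite normr_gt0 subr_eq0.
Qed.

Lemma continuous_projection : continuous (projection X).
Proof.
apply: (@lipschitz_cvg_continuous _ _ _ 1) => x y.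
by rewrite mul1r projection_nonexpansive.
Qed.

Lemma diameter_le x y : X x -> X y -> `|x - y| <= diameter X.
Proof.
move=> Xx Xy; apply: ub_le_sup; last by exists x => //; exists y.
have [M [_ hM]] := bX; exists (2 * (M + 1)) => _ [a Xa [b Xb <-]].
apply: (le_trans (ler_normB _ _)).
have := hM (M + 1); rewrite ltrDl ltr01 => /(_ isT) {}hM.
by have := hM _ Xa; have := hM _ Xb; rewrite /=; lra.
Qed.

(** The obtuse angle at the projected point q takes care of <v, q - y> and leaves the negative
    square of |x - q|. The remaining g <v, x - q> is controlled either by Young's inequality, using
    that square, or by Cauchy-Schwarz with |x - q| at most the diameter. *)
Lemma projection_step x y v (g : R) : 0 <= g -> X x -> X y ->
  g * dot v (x - y) <=
  (`|x - y| ^+ 2 - `|projection X (x - g *: v) - y| ^+ 2) / 2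
  + g * Num.min (g * `|v| ^+ 2 / 2) (diameter X * `|v|).
Proof.
move=> g0 Xx Xy; set q := projection X _.
have Xq : X q by exact: projection_in.
have h := @projection_obtuse (x - g *: v) y Xy; rewrite -/q in h.
have e : `|x - y| ^+ 2 = `|x - q| ^+ 2 + 2 * dot (x - q) (q - y) + `|q - y| ^+
  2.
  by rewrite -normD_sqr addrA subrK.
have {h} h : g * dot v (q - y) <= dot (x - q) (q - y).
  have -> : q - y = - (y - q) by rewrite opprB.
  rewrite !dotNr mulrN lerN2 -subr_le0; apply: le_trans h.
  by rewrite !dotE; lra.
have h1 : dot v (x - y) = dot v (x - q) + dot v (q - y).
  by rewrite -dotDr addrA subrK.
suff : g * dot v (x - q) - `|x - q| ^+ 2 / 2 <=
    g * Num.min (g * `|v| ^+ 2 / 2) (diameter X * `|v|).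
  by move=> ?; rewrite h1 e mulrDr; lra.
have hn := dot_le_norm v (x - q).
have [_|_] := leP (g * `|v| ^+ 2 / 2).
  have := sqr_ge0 (g * `|v| - `|x - q|).
  have : g * dot v (x - q) <= g * (`|v| * `|x - q|) by rewrite ler_wpM2l.
  by lra.
apply: (@le_trans _ _ (g * dot v (x - q))).
  by rewrite lerBlDr lerDl divr_ge0// sqr_ge0.
rewrite ler_wpM2l// (le_trans hn)// mulrC ler_wpM2r//.
exact: diameter_le.
Qed.

End Projection.

End InnerProduct.

Section Clip.
Context {R : realType} {H : completeNormedModType R} (dot : {dot H for idfun}).
Hypothesis dot_norm : forall x : H, dot x x = `|x| ^+ 2.
Variable l : R.
Hypothesis l_gt0 : 0 < l.
Implicit Types (u v : H).

Lemma clipE u : clip u l = (l / Num.max `|u| l) *: u.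
Proof.
rewrite /clip; case: (leP `|u| l) => ul; last by [].
by rewrite divff ?scale1r// gt_eqF.
Qed.

Lemma clip_le u : `|clip u l| <= l.
Proof.
rewrite /clip; case: (leP `|u| l) => // ul.
have u0 : 0 < `|u| by exact: (lt_trans l_gt0 ul).
by rewrite normrZ ger0_norm ?divr_ge0// ?(ltW l_gt0)// divfK ?gt_eqF.
Qed.

Lemma clip_le_norm u : `|clip u l| <= `|u|.
Proof.
case: (leP `|u| l) => ul; first by rewrite /clip ul.
exact: (le_trans (clip_le u) (ltW ul)).
Qed.

Lemma continuous_clip : continuous (fun u : H => clip u l).
Proof.
move=> u.
have -> : (fun u : H => clip u l) = (fun u => (l / Num.max `|u| l) *: u).
  by apply/funext => ?; rewrite clipE.
apply: cvgZ; last exact: cvg_id.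
apply: cvgMl_tmp; apply: cvgV; first by rewrite gt_eqF// lt_max l_gt0 orbT.
apply: (@continuous_max _ _ (fun u : H => `|u|) (fun=> l)); last exact: cvg_cst.
by apply: cvg_norm; exact: cvg_id.
Qed.

(** Clipping is the metric projection onto the ball of radius [l], and [v] is its own projection.
    The proof compares squares, whose difference has the factor [1 - s]. *)
Lemma clip_nonexpansive u v : `|v| <= l -> `|clip u l - v| <= `|u - v|.
Proof.
move=> vl; rewrite /clip; case: (leP `|u| l) => // ul.
have u0 : 0 < `|u| by exact: (lt_trans l_gt0 ul).
set s := l / `|u|.
have s0 : 0 <= s by rewrite divr_ge0// ltW.
have s1 : s <= 1 by rewrite ler_pdivrMr// mul1r ltW.
have duv : dot u v <= s * `|u| ^+ 2.
  rewrite (le_trans (dot_le_norm dot_norm u v))// /s expr2 mulrA divfK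
    ?gt_eqF//.
  by rewrite mulrC ler_wpM2r.
rewrite -(@ler_pXn2r _ 2) ?nnegrE// !(normB_sqr dot_norm) dotZl normrZ exprMn.
rewrite (ger0_norm s0) lerD2r -subr_ge0.
have -> : `|u| ^+ 2 - 2 * dot u v - (s ^+ 2 * `|u| ^+ 2 - 2 * (s * dot u v)) =
    (1 - s) * ((1 + s) * `|u| ^+ 2 - 2 * dot u v) by ring.
have h : 0 <= `|u| ^+ 2 by exact: sqr_ge0.
rewrite mulr_ge0 ?subr_ge0//; have : s * `|u| ^+ 2 <= `|u| ^+ 2.
  by rewrite ler_piMl.
by move=> ?; lra.
Qed.

(** Where clipping acts, [u] lies outside the ball of radius [l] while [v] has norm at most
    [l / (1 + e)], so |u - v| is at least [l * e / (1 + e)]. The excess |u| - l, at most |u - v|, is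
    therefore quadratic in |u - v|, and the variance controls its expectation. *)
Lemma clip_bias u v (e : R) : 0 < e -> (1 + e) * `|v| <= l ->
  `|u - clip u l| <= (1 + 1 / e) / l * `|u - v| ^+ 2.
Proof.
move=> e0 vl; have c0 : 0 <= (1 + 1 / e) / l.
  by rewrite divr_ge0 ?(ltW l_gt0)// addr_ge0// divr_ge0// ltW.
rewrite {1}/clip; case: (leP `|u| l) => ul.
  by rewrite subrr normr0 mulr_ge0// sqr_ge0.
have u0 : 0 < `|u| by exact: (lt_trans l_gt0 ul).
have -> : u - (l / `|u|) *: u = (1 - l / `|u|) *: u by rewrite scalerBl scale1r.
have lu1 : l / `|u| <= 1 by rewrite ler_pdivrMr// mul1r ltW.
rewrite normrZ ger0_norm ?subr_ge0// mulrBl mul1r divfK ?gt_eqF//.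
set r := `|u - v|.
have r1 : `|u| <= `|v| + r by rewrite addrC -{1}(subrK v u) ler_normD.
have v1 : `|v| <= l / (1 + e) by rewrite ler_pdivlMr 1?mulrC//; lra.
have el : l / (1 + e) <= l by rewrite ler_pdivrMr ?ler_peMr// ?ltW//; lra.
have r2 : l * e / (1 + e) <= r.
  have -> : l * e / (1 + e) = l - l / (1 + e) by field; lra.
  lra.
apply: (@le_trans _ _ r); first by lra.
have r0 : 0 <= r by exact: normr_ge0.
rewrite expr2 mulrA ler_peMl//.
have c1 : (1 + 1 / e) / l * (l * e / (1 + e)) = 1.
  by field; rewrite !gt_eqF//; lra.
apply: (@le_trans _ _ ((1 + 1 / e) / l * (l * e / (1 + e)))).
  by rewrite c1.
by rewrite !div1r in c0 *; rewrite ler_wpM2l.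
Qed.

End Clip.

(** * Weighted averages and the minimum of the objective *)

Section Average.
Context {R : realType} {H : completeNormedModType R} (dot : {dot H for idfun}).
Hypothesis dot_norm : forall x : H, dot x x = `|x| ^+ 2.
Variables (X : set H) (wt : nat -> R).
Hypotheses (cX : convex_set X) (wt0 : forall i, (0 < i)%N -> 0 < wt i).

Lemma sum_wt_gt0 k : (0 < k)%N -> 0 < \sum_(1 <= i < k.+1) wt i.
Proof.
elim: k => // -[|k] IH _; first by rewrite big_nat1 wt0.
by rewrite big_nat_recr//= addr_gt0 ?IH ?wt0.
Qed.

Lemma convex_set_average (x : nat -> H) k : (0 < k)%N ->
  (forall i, (0 < i)%N -> X (x i)) ->
  X ((\sum_(1 <= i < k.+1) wt i)^-1 *: \sum_(1 <= i < k.+1) wt i *: x i).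
Proof.
move=> + xX; elim: k => // -[|k] IH _.
  by rewrite !big_nat1 scalerA mulVf ?gt_eqF ?wt0// scale1r; exact: xX.
rewrite big_nat_recr//= [X in _ *: X]big_nat_recr//=.
set S := \sum_(1 <= i < _) wt i; set T := \sum_(1 <= i < _) _.
have S0 : 0 < S by exact: sum_wt_gt0.
have w0 : 0 < wt k.+2 by exact: wt0.
have Sw0 : 0 < S + wt k.+2 by exact: addr_gt0.
have := convex_set_segment (t := S / (S + wt k.+2)) cX (IH isT) (xX k.+2 isT).
have -> : 0 <= S / (S + wt k.+2) <= 1.
  rewrite ler_pdivrMr// mul1r lerDl (ltW w0) andbT.
  by rewrite divr_ge0// ltW.
move=> /(_ isT).
have -> : 1 - S / (S + wt k.+2) = (S + wt k.+2)^-1 * wt k.+2.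
  by field; rewrite gt_eqF.
rewrite -/S -/T !scalerA scalerDr scalerA.
by rewrite [S / _]mulrC mulfK// gt_eqF.
Qed.

(** Jensen's inequality through a subgradient at the average [z]: the weighted sum of the linear
    terms vanishes. *)
Lemma average_le (f : H -> R) (x : nat -> H) k : (0 < k)%N ->
  (forall i, (0 < i)%N -> X (x i)) ->
  (forall z, X z -> exists v, subdifferential dot f z v) ->
  (\sum_(1 <= i < k.+1) wt i) *
    f ((\sum_(1 <= i < k.+1) wt i)^-1 *: \sum_(1 <= i < k.+1) wt i *: x i)
  <= \sum_(1 <= i < k.+1) wt i * f (x i).
Proof.
move=> k0 xX sub; have := convex_set_average k0 xX.
set S := \sum_(1 <= i < _) wt i; set z := _ *: _ => Xz.
have S0 : 0 < S by exact: sum_wt_gt0.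
have [v hv] := sub _ Xz.
have -> : S * f z = \sum_(1 <= i < k.+1) wt i * (f z + dot (x i - z) v).
  under eq_bigr do rewrite mulrDr.
  rewrite big_split/= -mulr_suml -/S -[LHS]addr0; congr (_ + _).
  under eq_bigr do rewrite -dotZl scalerBr.
  have -> : \sum_(1 <= i < k.+1) dot (wt i *: x i - wt i *: z) v =
      dot (\sum_(1 <= i < k.+1) (wt i *: x i - wt i *: z)) v.
    elim: (k) => [|j IH]; first by rewrite !big_geq// linear0l.
    by rewrite [in LHS]big_nat_recr// [in RHS]big_nat_recr//= IH [RHS]dotDl.
  rewrite big_split/= sumrN -scaler_suml -/S /z scalerA divff ?scale1r
    ?gt_eqF//.
  by rewrite subrr linear0l.
by rewrite ler_sum_nat// => i /andP[i1 _]; rewrite ler_wpM2l ?(ltW (wt0 _))//;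
  exact: hv.
Qed.

End Average.

Lemma subgradient_norm_le (R : realType) (H : completeNormedModType R)
    (dot : {dot H for idfun}) (f : H -> R) (L : R) (x v : H) :
  (forall x : H, dot x x = `|x| ^+ 2) -> 0 <= L ->
  (forall x y, `|f x - f y| <= L * `|x - y|) -> subdifferential dot f x v ->
  `|v| <= L.
Proof.
move=> dn L0 fL /(_ (x + v)); rewrite addrAC subrr add0r dn => h.
have [->|v0] := eqVneq v 0; first by rewrite normr0.
have nv : 0 < `|v| by rewrite normr_gt0.
have := fL (x + v) x; rewrite addrAC subrr add0r => /(le_trans (ler_norm _)).
by move=> h'; rewrite -(ler_pM2r nv) -expr2; lra.
Qed.

Lemma min_value_attained (R : realType) (H : completeNormedModType R)
    (dot : {dot H for idfun}) (X : set H) (f : H -> R) (L : R) :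
  (forall x : H, dot x x = `|x| ^+ 2) -> X !=set0 -> closed X ->
  convex_set X -> bounded_set X -> 
  (forall x y, `|f x - f y| <= L * `|x - y|) ->
  (forall z, X z -> exists v, subdifferential dot f z v) ->
  exists2 x, X x & min_value X f = f x /\ forall y, X y -> f x <= f y.
Proof.
move=> dn X0 clX cX bX fL sub.
have cf : continuous f.
  by apply: (@lipschitz_cvg_continuous _ _ R^o f L).
have [x0 Xx0] := X0.
have midf x y : X x -> X y -> f (2^-1 *: (x + y)) <= (f x + f y) / 2.
  move=> Xx Xy; have Xm := convex_set_midpoint cX Xx Xy.
  have [v hv] := sub _ Xm; have := hv x; have := hv y.
  set z := 2^-1 *: _.
  have -> : y - z = - (x - z).
    apply/eqP; rewrite -addr_eq0 addrACA -opprD /z -scalerDl.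
    by rewrite -(mul1r 2^-1) -splitr scale1r [x + y]addrC subrr.
  by rewrite dotNl; lra.
have lbf x : X x -> f x0 - `|L| * diameter X <= f x.
  move=> Xx; have := le_trans (ler_norm _) (fL x0 x).
  have : L * `|x0 - x| <= `|L| * diameter X.
    apply: (@le_trans _ _ (`|L| * `|x0 - x|)); first by rewrite ler_wpM2r//
      ler_norm.
    by rewrite ler_wpM2l// diameter_le.
  by lra.
have [q Xq qmin] := convex_attains_min dn X0 clX cX bX cf midf lbf.
exists q => //; split => //.
pose Q := [set r | (f @` X) r /\ forall y, X y -> r <= f y].
have [[x Xx <-] h] : Q (min_value X f).
  by apply: (@xgetPex _ 0 Q); exists (f q); split => //; exists q.
by apply/eqP; rewrite eq_le qmin// h.
Qed.

(** * Independence and strong measurability *)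

Section Freezing.
Context {R : realType} {d d1 d2 : measure_display} {Omega : measurableType d}
  {T1 : measurableType d1} {T2 : measurableType d2} (P : probability Omega R).

Definition independent_pair (X1 : {RV P >-> T1}) (X2 : {RV P >-> T2}) : Prop :=
  forall A B, measurable A -> measurable B ->
    (P ((X1 @^-1` A) `&` (X2 @^-1` B)) = P (X1 @^-1` A) * P (X2 @^-1` B))%E.

(** The joint law and the product of the marginals agree on rectangles, hence coincide; Tonelli's
    theorem then integrates the second variable with the first one frozen. *)
Lemma integral_independent_pair (X1 : {RV P >-> T1}) (X2 : {RV P >-> T2})
    (F : T1 * T2 -> \bar R) :
  independent_pair X1 X2 -> measurable_fun setT F ->
  (forall z, 0 <= F z)%E ->
  (\int[P]_w F (X1 w, X2 w) = \int[P]_w \int[P]_w' F (X1 w, X2 w'))%E.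
Proof.
move=> ind mF F0.
have m1 : measurable_fun setT X1 by [].
have m2 : measurable_fun setT X2 by [].
have m12 : measurable_fun setT (fun w => (X1 w, X2 w)).
  exact: measurable_fun_pair.
pose Q1 := distribution P X1; pose Q2 := distribution P X2.
pose Q := pushforward P (fun w => (X1 w, X2 w)).
have eQ A : measurable A -> (Q1 \x Q2)%E A = Q A.
  apply: product_measure_unique => {}A B mA mB.
  by rewrite /Q1 /Q2 /= /distribution /pushforward -ind.
transitivity (\int[Q]_z F z)%E.
  by rewrite ge0_integral_pushforward// => z _; exact: F0.
transitivity (\int[(Q1 \x Q2)%E]_z F z)%E.
  apply: eq_measure_integral => A mA _; exact/esym/eQ.
rewrite fubini_tonelli1//.
rewrite [LHS]ge0_integral_pushforward//; last 2 first.
- exact: measurable_fun_fubini_tonelli_F.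
- by move=> x _; apply: integral_ge0.
apply: eq_integral => w _ /=.
rewrite /fubini_F ge0_integral_pushforward//.
by apply: measurableT_comp.
Qed.

Lemma measurable_integral_section (X1 : {RV P >-> T1}) (X2 : {RV P >-> T2})
    (F : T1 * T2 -> \bar R) :
  measurable_fun setT F -> (forall z, 0 <= F z)%E ->
  measurable_fun setT (fun w => \int[P]_w' F (X1 w, X2 w'))%E.
Proof.
move=> mF F0; pose Q2 := distribution P X2.
have -> : (fun w => \int[P]_w' F (X1 w, X2 w'))%E = fubini_F Q2 F \o X1.
  apply/funext => w /=; rewrite /fubini_F ge0_integral_pushforward//.
  by apply: measurableT_comp.
apply: measurableT_comp => //.
exact: measurable_fun_fubini_tonelli_F.
Qed.

End Freezing.

(** * Sigma-algebras generated by subfamilies of independent variables *)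

Section Cylinders.
Context {R : realType} {d dZ : measure_display} {Omega : measurableType d}
  {Z : measurableType dZ} (P : probability Omega R) {I : choiceType}
  (Y : I -> {RV P >-> Z}).
Implicit Types (J : set I) (K : {fset I}).

(** Pi-system generating the sigma-algebra of the variables indexed by [J]. Finite intersections
    match the form of [mutually_independent], so the product formula applies to them directly. *)
Definition cylinders J : set (set Omega) :=
  [set A | exists K (B : I -> set Z), [/\ [set` K] `<=` J,
     forall i, measurable (B i) & A = \bigcap_(i in [set` K]) (Y i @^-1` B i)]].

Lemma measurable_preimage_rv i (B : set Z) :
  measurable B -> measurable (Y i @^-1` B).
Proof.
by move=> mB; rewrite -[_ @^-1` _]setTI; exact: measurable_funP.
Qed.

Lemma sub_cylinders_measurable J : cylinders J `<=` measurable.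
Proof.
move=> _ [K [B [_ mB ->]]]; apply: fin_bigcap_measurable => // i _.
exact: measurable_preimage_rv.
Qed.

Lemma sub_cylinders J J' : J `<=` J' -> cylinders J `<=` cylinders J'.
Proof.
move=> JJ' _ [K [B [KJ mB ->]]]; exists K, B; split => //.
exact: subset_trans JJ'.
Qed.

Lemma cylindersT J : cylinders J setT.
Proof.
exists fset0, (fun=> setT); split => //.
by rewrite set_fset0 bigcap_set0.
Qed.

Lemma cylinders_preimage J i (B : set Z) : J i -> measurable B ->
  cylinders J (Y i @^-1` B).
Proof.
move=> Ji mB; exists [fset i]%fset, (fun=> B); split => //.
  by rewrite set_fset1 => _ ->.
by rewrite set_fset1 bigcap_set1.
Qed.

Lemma setI_closed_cylinders J : setI_closed (cylinders J).
Proof.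
move=> _ _ [K1 [B1 [KJ1 mB1 ->]]] [K2 [B2 [KJ2 mB2 ->]]].
exists (K1 `|` K2)%fset, (fun i => (if i \in K1 then B1 i else setT) `&`
  (if i \in K2 then B2 i else setT)); split.
- move=> i /=; rewrite inE => /orP[]; [exact: KJ1|exact: KJ2].
- by move=> i; apply: measurableI; case: ifP.
apply/seteqP; split => [w [h1 h2] i /= _|w h].
  by split => /=; case: ifPn => // iK; [exact: h1|exact: h2].
split => i /= iK.
  by have := h i; rewrite /= inE iK => /(_ isT)[].
by have := h i; rewrite /= inE iK orbT => /(_ isT)[].
Qed.

Definition history J := g_sigma_algebraType (cylinders J).

Lemma measurable_history J (A : set Omega) :
  <<s cylinders J >> A -> d.-measurable A.
Proof.
apply: smallest_sub; last exact: sub_cylinders_measurable.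
exact: sigma_algebra_measurable.
Qed.

Lemma sub_history J J' : J `<=` J' ->
  <<s cylinders J >> `<=` <<s cylinders J' >>.
Proof. by move=> JJ'; apply: sub_sigma_algebra2; exact: sub_cylinders. Qed.

Hypothesis (D : set I) (indY : mutually_independent D Y).

Lemma cylinders_independent J1 J2 (A B : set Omega) : J1 `<=` D -> J2 `<=` D ->
  J1 `&` J2 = set0 -> cylinders J1 A -> cylinders J2 B ->
  (P (A `&` B) = P A * P B)%E.
Proof.
move=> J1D J2D J12 [K1 [B1 [KJ1 mB1 ->]]] [K2 [B2 [KJ2 mB2 ->]]].
have K12 i : i \in K1 -> i \in K2 -> False.
  move=> i1 i2; have : (J1 `&` J2) i by split; [exact: KJ1|exact: KJ2].
  by rewrite J12.
pose B0 i := if i \in K1 then B1 i else B2 i.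
have mB0 i : measurable (B0 i) by rewrite /B0; case: ifP.
have B1E i : i \in K1 -> B0 i = B1 i by rewrite /B0 => ->.
have B2E i : i \in K2 -> B0 i = B2 i.
  by rewrite /B0 => iK2; case: ifPn => // /K12/(_ iK2).
have -> : (\bigcap_(i in [set` K1]) Y i @^-1` B1 i) `&`
    (\bigcap_(i in [set` K2]) Y i @^-1` B2 i) =
    \bigcap_(i in [set` (K1 `|` K2)%fset]) Y i @^-1` B0 i.
  apply/seteqP; split => [w [h1 h2] i /=|w h].
    rewrite inE => /orP[] iK.
      by rewrite B1E//; exact: h1.
    by rewrite B2E//; exact: h2.
  split => i /= iK.
    by have := h i; rewrite /= inE iK B1E//; exact.
  by have := h i; rewrite /= inE iK orbT B2E//; exact.
rewrite !indY//.
- rewrite (perm_big (K1 ++ K2)); last first.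
    apply: uniq_perm => //; last by move=> i; rewrite mem_cat inE.
    rewrite cat_uniq !fset_uniq/= andbT; apply/hasPn => i iK2.
    by apply/negP => iK1; exact: (K12 i).
  rewrite big_cat/=; congr (_ * _)%E; rewrite !big_seq; apply: eq_bigr => i iK.
    by rewrite B1E.
  by rewrite B2E.
- exact: subset_trans KJ2 _.
- exact: subset_trans KJ1 _.
- by move=> i /=; rewrite inE => /orP[] ?; [apply/J1D/KJ1|apply/J2D/KJ2].
Qed.

(** Uniqueness of measures on a pi-system, used once for each event: with [C] fixed, the restriction
    of [P] to [C] and the multiple of [P] by the mass of [C] agree on the cylinders. *)
Lemma history_independent J1 J2 (A B : set Omega) : J1 `<=` D -> J2 `<=` D ->
  J1 `&` J2 = set0 -> <<s cylinders J1 >> A -> <<s cylinders J2 >> B ->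
  (P (A `&` B) = P A * P B)%E.
Proof.
move=> J1D J2D J12 sA sB.
have unique (C : set Omega) J : d.-measurable C ->
    (forall A, cylinders J A -> P (A `&` C) = P A * P C)%E ->
    forall A, <<s cylinders J >> A -> (P (A `&` C) = P A * P C)%E.
  move=> mC h A' sA'.
  have PC : P C \is a fin_num by exact: fin_num_measure.
  have PC0 : (0 <= fine (P C))%R by exact: fine_ge0.
  pose m1 := mrestr P mC; pose m2 := mscale (NngNum PC0) P.
  have -> : P (A' `&` C) = m1 A' by [].
  have m2E X : (m2 X = P X * P C)%E by rewrite /m2 /mscale/= muleC fineK.
  rewrite -m2E.
  apply: (@g_sigma_algebra_measure_unique _ _ _ (cylinders J)
    (@sub_cylinders_measurable J) (fun=> setT) _ _ m1 m2).
  - by move=> _; exact: cylindersT.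
  - by rewrite bigcup_const//; exists 0%N.
  - exact: setI_closed_cylinders.
  - move=> A'' cA''; transitivity (P A'' * P C)%E; first exact: h.
    exact: (esym (m2E A'')).
  - move=> _; apply: (@le_lt_trans _ _ 1%E); last by rewrite ltry.
    by apply: probability_le1; apply: measurableI.
  - exact: sA'.
apply: (unique B J1) => //; first exact: measurable_history sB.
move=> {A sA} A cA; rewrite setIC muleC.
apply: (unique A J2) => //; first exact: sub_cylinders_measurable cA.
move=> {B sB} B cB; rewrite setIC muleC.
exact: (cylinders_independent J1D J2D J12).
Qed.

End Cylinders.

(** * Strong measurability and its stability *)

Section StronglyMeasurable.
Context {R : realType}.

Lemma simple_preimage (V : completeNormedModType R) d (T : measurableType d)
    (s : T -> V) (A : set V) :
  finite_set (range s) -> (forall v, measurable (s @^-1` [set v])) ->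
  measurable (s @^-1` A).
Proof.
move=> fs ms.
have -> : s @^-1` A = \bigcup_(v in range s `&` A) (s @^-1` [set v]).
  apply/seteqP; split => [t At|t [v [_ Av] /= ->]//].
  by exists (s t) => //; split => //; exists t.
apply: fin_bigcup_measurable; first exact: finite_setIl.
by move=> v _; exact: ms.
Qed.

Lemma strongly_measurable_cst (V : completeNormedModType R) d
    (T : measurableType d) (D : set T) (v : V) :
  strongly_measurable D (fun=> v).
Proof.
exists (fun=> fun=> v); split; last by move=> t _; exact: cvg_cst.
move=> _; split; last by move=> w; rewrite preimage_cst; case: ifP.
by apply: (sub_finite_set _ (finite_set1 v)) => _ [t _ <-].
Qed.

Lemma strongly_measurable_op2 (V1 V2 V3 : completeNormedModType R) d
    (T : measurableType d) (D : set T) (op : V1 -> V2 -> V3) f g :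
  (forall (a : nat -> V1) (b : nat -> V2) x y,
    a @ \oo --> x -> b @ \oo --> y ->
    (fun n => op (a n) (b n)) @ \oo --> op x y) ->
  strongly_measurable D f -> strongly_measurable D g ->
  strongly_measurable D (fun t => op (f t) (g t)).
Proof.
move=> op_cvg [s [ss fs]] [r [rr gr]].
exists (fun n t => op (s n t) (r n t)); split; last first.
  by move=> t Dt; apply: op_cvg; [exact: fs|exact: gr].
move=> n; have [fins ms] := ss n; have [finr mr] := rr n.
split.
  apply: (@sub_finite_set _ _
    [set op x.1 x.2 | x in range (s n) `*` range (r n)]).
    by move=> _ [t _ <-]; exists (s n t, r n t) => //; split; exists t.
  by apply: finite_image; exact: finite_setX.
move=> v.
have -> : (fun t => op (s n t) (r n t)) @^-1` [set v] =
    \bigcup_(x in range (s n)) (s n @^-1` [set x] `&`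
      r n @^-1` [set y | op x y = v]).
  apply/seteqP; split => [t /= <-|t [x _ [/= -> ]]//].
  by exists (s n t) => //; exists t.
apply: fin_bigcup_measurable => // x _; apply: measurableI; first exact: ms.
exact: simple_preimage.
Qed.

Lemma strongly_measurable_op1 (V1 V2 : completeNormedModType R) d
    (T : measurableType d) (D : set T) (op : V1 -> V2) f :
  continuous op -> strongly_measurable D f ->
  strongly_measurable D (op \o f).
Proof.
move=> cop mf.
apply: (@strongly_measurable_op2 V1 V1 V2 _ _ _ (fun x _ => op x) f f) => //.
by move=> a b x y ax _; apply: continuous_cvg; [exact: cop|exact: ax].
Qed.

Lemma strongly_measurable_comp (V : completeNormedModType R) d d'
    (T : measurableType d) (T' : measurableType d') (D : set T) (D' : set T')
    (phi : T' -> T) (f : T -> V) :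
  measurable_fun setT phi -> (forall t, D' t -> D (phi t)) ->
  strongly_measurable D f -> strongly_measurable D' (f \o phi).
Proof.
move=> mphi DD [s [ss fs]].
exists (fun n => s n \o phi); split; last by move=> t Dt; exact/fs/DD.
move=> n; have [fins ms] := ss n; split.
  by apply: (sub_finite_set _ fins) => _ [t _ <-]; exists (phi t).
by move=> v; rewrite comp_preimage -[X in measurable X]setTI; exact: mphi.
Qed.

Lemma strongly_measurable_fun d (T : measurableType d) (f : T -> R^o) :
  strongly_measurable setT f -> measurable_fun setT (f : T -> R).
Proof.
move=> [s [ss fs]]; apply: (@measurable_fun_cvg _ _ _ _ s) => // n.
have [fins ms] := ss n.
by move=> _ B mB; rewrite setTI; exact: simple_preimage.
Qed.

Lemma strongly_measurable_borel (V : completeNormedModType R) d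
    (T : measurableType d) (f : T -> V) :
  strongly_measurable setT f ->
  measurable_fun setT (f : T -> g_sigma_algebraType (@open V)).
Proof.
move=> [s [ss fs]].
apply: (@measurability _ _ T (g_sigma_algebraType (@open V)) setT f (@open V)).
  by [].
move=> _ [U oU <-]; rewrite setTI.
(* [Um m] shrinks [U] by 1 / (m + 1), so that the limit is in [U] exactly when the approximants are
   eventually in some [Um m]. Its preimages are measurable whatever its own structure, since each
   [s n] has finite range. *)
pose Um m := [set y : V | ball y m.+1%:R^-1 `<=` U].
have -> : f @^-1` U =
    \bigcup_m \bigcup_N \bigcap_(n in [set n | (N <= n)%N]) (s n @^-1` Um m).
  apply/seteqP; split => [t Ut|t [m _ [N _ h]]].
    have /= : nbhs (f t) U by exact: open_nbhs_nbhs.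
    rewrite -nbhs_ballE => -[e /= e0 eU].
    have [m me] : exists m : nat, m.+1%:R^-1 < e / 2.
      have e20 : 0 < e / 2 by rewrite divr_gt0.
      by have [m _ hm] := near_infty_natSinv_lt (PosNum e20); exists m; apply:
        hm => /=.
    exists m => //.
    have := fs t I; move/cvg_ballP => /(_ _ (divr_gt0 e0 (ltr0n _ 2))).
    case=> N _ hN; exists N => // n /= Nn y sy; apply: eU.
    rewrite [e]splitr; apply: ball_triangle (hN n Nn) _.
    exact: le_ball (ltW me) _ sy.
  have m0 : 0 < m.+1%:R^-1 :> R by rewrite invr_gt0.
  have := fs t I; move/cvg_ballP => /(_ _ m0)[N' _ hN'].
  have := h (maxn N N') (leq_maxl _ _); apply.
  by apply: ball_sym; apply: hN'; exact: leq_maxr.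
apply: bigcup_measurable => m _; apply: bigcup_measurable => N _.
apply: bigcap_measurable => [|n _]; first by exists N => /=.
by have [fins ms] := ss n; exact: simple_preimage.
Qed.

Lemma strongly_measurable_separable (V : completeNormedModType R) d
    (T : measurableType d) (f : T -> V) :
  strongly_measurable setT f -> separable_set (range f).
Proof.
move=> [s [ss fs]]; exists (\bigcup_n range (s n)).
  by apply: bigcup_countable => // n _; apply: finite_set_countable; case: (ss
    n).
move=> _ [t _ <-] B nB.
have [N _ hN] := fs t I B nB.
by exists (s N t); split; [exists N => //; exists t|exact: hN (leqnn N)].
Qed.

(** The range of a strongly measurable map is separable, which makes it an admissible set [A] in
    [jointly_measurable]. *)
Lemma jointly_measurable_comp (V : completeNormedModType R) d dZ
    (T : measurableType d) (Z : measurableType dZ) (X : set V)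
    (u : V -> Z -> V) (x : T -> V) (z : T -> Z) :
  jointly_measurable X u -> strongly_measurable setT x -> (forall t, X (x t)) ->
  measurable_fun setT z -> strongly_measurable setT (fun t => u (x t) (z t)).
Proof.
move=> ju mx xX mz.
have xA : range x `<=` X by move=> _ [t _ <-].
have hj := ju _ xA (strongly_measurable_separable mx).
have mphi : measurable_fun setT
    (fun t => (x t : g_sigma_algebraType (@open V), z t)).
  by apply: measurable_fun_pair => //; exact: strongly_measurable_borel.
apply: (strongly_measurable_comp mphi _ hj).
by move=> t _; split => //; exists t.
Qed.

End StronglyMeasurable.

(** * One batch *)

Section SameLaw.
Context {R : realType} {d d' : measure_display} {Omega : measurableType d}
  {T : measurableType d'} (P : probability Omega R) (X1 X2 : {RV P >-> T}).
Hypothesis same_law : forall B, measurable B ->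
  distribution P X1 B = distribution P X2 B.
Implicit Types f : T -> \bar R.

Lemma ge0_integral_same_law f : measurable_fun setT f -> (forall z, 0 <= f z)%E
  ->
  (\int[P]_w f (X1 w) = \int[P]_w f (X2 w))%E.
Proof.
move=> mf f0.
have push (X : {RV P >-> T}) :
    (\int[P]_w f (X w) = \int[distribution P X]_z f z)%E.
  by rewrite ge0_integral_pushforward// => z _; exact: f0.
by rewrite !push; apply: eq_measure_integral => A mA _; exact: same_law.
Qed.

Lemma integrable_same_law f : measurable_fun setT f ->
  P.-integrable setT (f \o X2) -> P.-integrable setT (f \o X1).
Proof.
move=> mf /integrableP[_ fi]; apply/integrableP; split.
  exact: measurableT_comp.
apply: le_lt_trans fi; rewrite le_eqVlt; apply/orP; left; apply/eqP.
apply: (@ge0_integral_same_law (abse \o f)).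
  exact: measurableT_comp.
by move=> z; exact: abse_ge0.
Qed.

Lemma integral_same_law f : measurable_fun setT f ->
  P.-integrable setT (f \o X2) ->
  (\int[P]_w f (X1 w) = \int[P]_w f (X2 w))%E.
Proof.
move=> mf fi.
have push (X : {RV P >-> T}) : P.-integrable setT (f \o X) ->
    (\int[P]_w f (X w) = \int[distribution P X]_z f z)%E.
  by move=> fX; rewrite (integral_pushforward _ _ fX).
rewrite !push//; last exact: integrable_same_law.
by apply: eq_measure_integral => A mA _; exact: same_law.
Qed.

End SameLaw.

Lemma integral_affine {R : realType} d (T : measurableType d)
    (mu : {measure set T -> \bar R}) (D : set T) (f1 f2 f3 : T -> R) (a : R) :
  measurable D -> mu.-integrable D (EFin \o f1) ->
  mu.-integrable D (EFin \o f2) -> mu.-integrable D (EFin \o f3) ->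
  (\int[mu]_(x in D) (f1 x + a * f2 x + f3 x)%:E =
   \int[mu]_(x in D) (f1 x)%:E + a%:E * \int[mu]_(x in D) (f2 x)%:E
   + \int[mu]_(x in D) (f3 x)%:E)%E.
Proof.
move=> mD i1 i2 i3; under eq_integral do rewrite EFinD EFinD EFinM.
have i2' : mu.-integrable D (fun x => a%:E * (f2 x)%:E)%E by exact:
  integrableZl.
rewrite integralD//; last exact: integrableD.
by rewrite integralD// integralZl.
Qed.

Section Batch.
Context {R : realType} {H : completeNormedModType R} (dot : {dot H for idfun}).
Hypothesis dot_norm : forall x : H, dot x x = `|x| ^+ 2.
Context {d dZ : measure_display} {Omega : measurableType d}
  {Z : measurableType dZ} (P : probability Omega R).
Variables (xi : {RV P >-> Z}) (U : Z -> H) (v : H) (sigma : R).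
Hypotheses (mU : strongly_measurable setT U)
  (Uv : is_expectation P dot (fun w => U (xi w)) v)
  (Uvar : (\int[P]_w (`|U (xi w) - v| ^+ 2)%:E <= (sigma ^+ 2)%:E)%E).

Let g (y : H) (z : Z) : R := dot (U z - v) y.
Let q (z : Z) : R := `|U z - v| ^+ 2.

Let mUv : strongly_measurable setT (fun z => U z - v).
Proof.
apply: (@strongly_measurable_op2 _ H H H _ _ _ (fun a b => a - b) _ _ _ mU
  (strongly_measurable_cst _ v)).
by move=> a b x y ax bx; exact: cvgB.
Qed.

Let mg y : measurable_fun setT (g y).
Proof.
apply: strongly_measurable_fun.
apply: (@strongly_measurable_op2 _ H H R^o _ _ _ dot _ _ _ mUv
  (strongly_measurable_cst _ y)).
by move=> a b x z ax bx; exact: cvg_dot.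
Qed.

Let mq : measurable_fun setT q.
Proof.
apply: strongly_measurable_fun.
have -> : q = fun z => dot (U z - v) (U z - v).
  by apply/funext => z; rewrite dot_norm.
apply: (@strongly_measurable_op2 _ H H R^o _ _ _ dot _ _ _ mUv mUv).
by move=> a b x z ax bx; exact: cvg_dot.
Qed.

Variables (m : nat) (zeta : 'I_m -> {RV P >-> Z}).
Hypotheses (zeta_law : forall j B, measurable B ->
    distribution P (zeta j) B = distribution P xi B)
  (zeta_ind : forall i j, i != j -> independent_pair (zeta i) (zeta j)).

Let mgE y : measurable_fun setT (EFin \o g y). Proof. exact: measurableT_comp.
  Qed.
Let mqE : measurable_fun setT (EFin \o q). Proof. exact: measurableT_comp. Qed.

Let integrable_g_xi y : P.-integrable setT ((EFin \o g y) \o xi).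
Proof.
have [_ iU _] := Uv.
apply: (@le_integrable _ _ _ _ _ _ _
  (fun w => ((`|U (xi w)| + `|v|) * `|y|)%:E)) => //.
- exact: measurableT_comp.
- move=> w _ /=; rewrite lee_fin.
  rewrite [leRHS]ger0_norm ?mulr_ge0 ?addr_ge0//.
  apply: le_trans (abs_dot_le_norm dot_norm _ _) _.
  by rewrite ler_wpM2r// ler_normB.
- under eq_fun do rewrite EFinM EFinD muleC.
  apply: integrableZl => //; apply: integrableD => //.
  exact: finite_measure_integrable_cst.
Qed.

Let integral_g_xi y : (\int[P]_w (g y (xi w))%:E = 0)%E.
Proof.
have [_ iU eU] := Uv.
have := eU y; rewrite unlock => e.
have e' : (fun w => (dot (U (xi w)) y)%:E) = (fun w => (g y (xi w) + dot v
  y)%:E).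
  by apply/funext => w; rewrite /g !dotE subrK.
move: e; rewrite e'; under eq_integral do rewrite EFinD.
rewrite integralD//; last 2 first.
- exact: (integrable_g_xi y).
- exact: finite_measure_integrable_cst.
have PT : P setT = 1%E := probability_setT P.
rewrite integral_cst// [X in (_ * X)%E]PT mule1.
move=> h; have := @addeK _ (dot v y)%:E (\int[P]_w (g y (xi w))%:E)%E isT.
by rewrite h subee.
Qed.

Lemma integrable_g j y : P.-integrable setT (fun w => (g y (zeta j w))%:E).
Proof. by apply: (integrable_same_law (zeta_law j) (mgE y)). Qed.

Lemma integral_g j y : (\int[P]_w (g y (zeta j w))%:E = 0)%E.
Proof.
by rewrite (integral_same_law (zeta_law j) (mgE y)) ?integral_g_xi.
Qed.

Lemma integral_q j : (\int[P]_w (q (zeta j w))%:E <= (sigma ^+ 2)%:E)%E.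
Proof.
rewrite (ge0_integral_same_law (zeta_law j) mqE)// => z.
by rewrite lee_fin sqr_ge0.
Qed.

Lemma integrable_q j : P.-integrable setT (fun w => (q (zeta j w))%:E).
Proof.
apply/integrableP; split; first exact: (measurableT_comp mqE).
apply: (@le_lt_trans _ _ (sigma ^+ 2)%:E); last by rewrite ltry.
apply: le_trans (integral_q j); rewrite le_eqVlt; apply/orP; left; apply/eqP.
by apply: eq_integral => w _; rewrite gee0_abs// lee_fin sqr_ge0.
Qed.

Let c i j (w : Omega) : R := dot (U (zeta i w) - v) (U (zeta j w) - v).

Lemma dot_sumr (I : Type) (r : seq I) (F : I -> H) x :
  dot x (\sum_(i <- r) F i) = \sum_(i <- r) dot x (F i).
Proof.
elim: r => [|i r IH]; first by rewrite !big_nil linear0r.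
by rewrite !big_cons dotDr IH.
Qed.

Lemma dot_suml (I : Type) (r : seq I) (F : I -> H) x :
  dot (\sum_(i <- r) F i) x = \sum_(i <- r) dot (F i) x.
Proof. by rewrite dotC dot_sumr; under eq_bigr do rewrite dotC. Qed.

Let mc i j : measurable_fun setT (c i j).
Proof.
apply: strongly_measurable_fun.
have ma k : strongly_measurable setT (fun w => U (zeta k w) - v).
  by apply: (strongly_measurable_comp (phi := zeta k) (D' := setT) _ _ mUv).
apply: (@strongly_measurable_op2 _ H H R^o _ _ _ dot _ _ _ (ma i) (ma j)).
by move=> a b x z ax bx; exact: cvg_dot.
Qed.

Let integrable_c i j : P.-integrable setT (fun w => (c i j w)%:E).
Proof.
apply: (@le_integrable _ _ _ _ _ _ _
  (fun w => (q (zeta i w) + q (zeta j w))%:E)) => //.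
- exact: measurableT_comp.
- move=> w _ /=; rewrite lee_fin [leRHS]ger0_norm ?addr_ge0 ?sqr_ge0//.
  apply: le_trans (abs_dot_le_norm dot_norm _ _) _.
  rewrite /q; set x := `|_|; set y := `|_|.
  have := sqr_ge0 (x - y); have := sqr_ge0 (x + y).
  by move=> h1 h2; lra.
- under eq_fun do rewrite EFinD.
  by apply: integrableD => //; exact: integrable_q.
Qed.

(* Freezing applied to [|(U z - v) + (U z' - v)|^2], which is nonnegative, gives
   [E|a_i + a_j|^2 = E|a_i|^2 + E|a_j|^2]. *)
Let integral_c i j : i != j -> (\int[P]_w (c i j w)%:E = 0)%E.
Proof.
move=> ij; pose Fs (z : Z * Z) : R := `|(U z.1 - v) + (U z.2 - v)| ^+ 2.
have FsE z : Fs z = q z.1 + g (U z.1 - v) z.2 *+ 2 + q z.2.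
  by rewrite /Fs (normD_sqr dot_norm) /q /g (dotC dot (U z.2 - v)); ring.
have mFs : measurable_fun setT Fs.
  apply: strongly_measurable_fun.
  have ma (phi : Z * Z -> Z) : measurable_fun setT phi ->
      strongly_measurable setT (fun z => U (phi z) - v).
    by move=> mphi; apply: (strongly_measurable_comp (D' := setT) mphi _ mUv).
  have ms : strongly_measurable setT
      (fun z : Z * Z => (U z.1 - v) + (U z.2 - v)).
    apply: (@strongly_measurable_op2 _ H H H _ _ _ (fun a b => a + b) _ _ _
      (ma _ measurable_fst) (ma _ measurable_snd)).
    by move=> a b x y ax bx; exact: cvgD.
  have -> : Fs = fun z => dot ((U z.1 - v) + (U z.2 - v))
      ((U z.1 - v) + (U z.2 - v)) by apply/funext => z; rewrite dot_norm.
  apply: (@strongly_measurable_op2 _ H H R^o _ _ _ dot _ _ _ ms ms).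
  by move=> a b x z ax bx; exact: cvg_dot.
have qfin k : (\int[P]_w (q (zeta k w))%:E)%E \is a fin_num.
  by apply: integrable_fin_num => //; exact: integrable_q.
have cfin : (\int[P]_w (c i j w)%:E)%E \is a fin_num.
  exact: integrable_fin_num.
have mFsE : measurable_fun setT (EFin \o Fs) by exact: measurableT_comp.
have Fs0 z : (0 <= (EFin \o Fs) z)%E by rewrite lee_fin sqr_ge0.
have := integral_independent_pair (zeta_ind ij) mFsE Fs0.
have -> : (\int[P]_w (EFin \o Fs) (zeta i w, zeta j w) =
    \int[P]_w (q (zeta i w))%:E + 2%:E * \int[P]_w (c i j w)%:E
    + \int[P]_w (q (zeta j w))%:E)%E.
  rewrite -integral_affine//;
    [|exact: integrable_q|exact: integrable_c|exact: integrable_q].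
  by apply: eq_integral => w _; rewrite /= FsE /= mulr_natl /g (dotC dot).
have -> : (\int[P]_w \int[P]_w' (EFin \o Fs) (zeta i w, zeta j w') =
    \int[P]_w (q (zeta i w))%:E + \int[P]_w (q (zeta j w))%:E)%E.
  transitivity (\int[P]_w (q (zeta i w) +
      fine (\int[P]_w' (q (zeta j w'))%:E))%:E)%E.
    apply: eq_integral => w _.
    transitivity (\int[P]_w' (q (zeta i w) + 2 * g (U (zeta i w) - v) (zeta j
      w')
        + q (zeta j w'))%:E)%E.
      by apply: eq_integral => w' _; rewrite /= FsE /= mulr_natl.
    rewrite integral_affine//; last 3 first.
    - exact: finite_measure_integrable_cst.
    - exact: integrable_g.
    - exact: integrable_q.
    rewrite integral_g mule0 adde0 EFinD fineK//; congr (_ + _)%E.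
    by rewrite integral_cst// [X in (_ * X)%E](probability_setT P) mule1.
  under eq_integral do rewrite EFinD.
  rewrite integralD//; last 2 first.
  - exact: integrable_q.
  - exact: finite_measure_integrable_cst.
  rewrite integral_cst// [X in (_ * X)%E](probability_setT P) mule1 fineK//.
move: (qfin i) (qfin j) cfin.
case: (\int[P]_w (q (zeta i w))%:E)%E => // ci _.
case: (\int[P]_w (q (zeta j w))%:E)%E => // cj _.
case: (\int[P]_w (c i j w)%:E)%E => // cc _.
rewrite -EFinM -!EFinD => -[] e; congr EFin; lra.
Qed.

Let batch_mean (w : Omega) : H := m%:R^-1 *: \sum_(j < m) U (zeta j w).

Hypothesis m_gt0 : (0 < m)%N.

Let batch_meanE w :
  batch_mean w - v = m%:R^-1 *: \sum_(j < m) (U (zeta j w) - v).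
Proof.
rewrite big_split/= sumr_const card_ord scalerDr; congr (_ + _).
by rewrite -[(- v) *+ m]scaler_nat scalerA mulVf ?scale1r// pnatr_eq0 -lt0n.
Qed.

Lemma integral_batch_mean y :
  P.-integrable setT (fun w => (dot (batch_mean w - v) y)%:E) /\
  (\int[P]_w (dot (batch_mean w - v) y)%:E = 0)%E.
Proof.
have -> : (fun w => (dot (batch_mean w - v) y)%:E) =
    (fun w => (m%:R^-1)%:E * \sum_(j < m) (g y (zeta j w))%:E)%E.
  apply/funext => w; rewrite batch_meanE dotZl dot_suml EFinM.
  by rewrite sumEFin.
have ig j := integrable_g j y.
have isum : P.-integrable setT (fun w => \sum_(j < m) (g y (zeta j w))%:E)%E.
  by apply: integrable_sum => // j _.
split; first exact: integrableZl.
rewrite integralZl// integral_sum//.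
by rewrite big1 ?mule0// => j _; exact: integral_g.
Qed.

Lemma integral_batch_var :
  P.-integrable setT (fun w => (`|batch_mean w - v| ^+ 2)%:E) /\
  (\int[P]_w (`|batch_mean w - v| ^+ 2)%:E <= (sigma ^+ 2 / m%:R)%:E)%E.
Proof.
have -> : (fun w => (`|batch_mean w - v| ^+ 2)%:E) =
    (fun w => (m%:R^-1 ^+ 2)%:E * \sum_(i < m) \sum_(j < m) (c i j w)%:E)%E.
  apply/funext => w; rewrite batch_meanE -dot_norm dotZl dotZr mulrA -expr2.
  rewrite dot_suml EFinM -sumEFin; congr (_ * _)%E; apply: eq_bigr => i _.
  by rewrite dot_sumr sumEFin.
have isum i : P.-integrable setT (fun w => \sum_(j < m) (c i j w)%:E)%E.
  by apply: integrable_sum => // j _.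
have iss : P.-integrable setT (fun w => \sum_(i < m) \sum_(j < m) (c i j
  w)%:E)%E.
  by apply: integrable_sum => // j _.
split; first exact: integrableZl.
rewrite integralZl// integral_sum//.
have h i : (\int[P]_w \sum_(j < m) (c i j w)%:E <= (sigma ^+ 2)%:E)%E.
  rewrite integral_sum// (bigD1 i)//= big1 ?adde0; last first.
    by move=> j ji; apply: integral_c; rewrite eq_sym.
  apply: le_trans (integral_q i); rewrite le_eqVlt; apply/orP; left; apply/eqP.
  by apply: eq_integral => w _; rewrite /c dot_norm.
apply: (@le_trans _ _ ((m%:R^-1 ^+ 2)%:E * \sum_(i < m) (sigma ^+ 2)%:E)%E).
  by apply: lee_wpmul2l; [rewrite lee_fin sqr_ge0|exact: lee_sum].
rewrite sumEFin -EFinM lee_fin sumr_const card_ord -mulr_natr.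
rewrite le_eqVlt; apply/orP; left; apply/eqP; field.
by rewrite pnatr_eq0 -lt0n.
Qed.

(** The form in which the moments are used. The linear term has mean 0 and may have a coefficient of
    any sign; [a2] is nonnegative because the variance is only bounded above. *)
Lemma integral_batch_le (Phi : Omega -> R) (a0 a1 a2 : R) (y : H) :
  measurable_fun setT Phi -> (forall w, 0 <= Phi w) -> 0 <= a2 ->
  (forall w, Phi w <=
    a0 + a1 * dot (batch_mean w - v) y + a2 * `|batch_mean w - v| ^+ 2) ->
  (\int[P]_w (Phi w)%:E <= (a0 + a2 * (sigma ^+ 2 / m%:R))%:E)%E.
Proof.
move=> mPhi Phi0 a20 PhiE.
have [ig eg] := integral_batch_mean y.
have [iq eq] := integral_batch_var.
have ia2 : P.-integrable setT
    (EFin \o (fun w => a2 * `|batch_mean w - v| ^+ 2)).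
  rewrite (_ : EFin \o _ = fun w => (a2%:E * (`|batch_mean w - v| ^+
    2)%:E)%E)//.
  exact: integrableZl.
have icst : P.-integrable setT (EFin \o (fun=> a0) : Omega -> _).
  exact: finite_measure_integrable_cst.
have iaff : P.-integrable setT (EFin \o (fun w =>
    a0 + a1 * dot (batch_mean w - v) y + a2 * `|batch_mean w - v| ^+ 2)).
  rewrite (_ : EFin \o _ = fun w => ((a0%:E + a1%:E *
    (dot (batch_mean w - v) y)%:E) + (a2 * `|batch_mean w - v| ^+ 2)%:E)%E)//.
  by apply: integrableD => //; apply: integrableD => //; exact: integrableZl.
have /integrableP[miaff _] := iaff.
apply: (@le_trans _ _ (\int[P]_w (a0 + a1 * dot (batch_mean w - v) y +
    a2 * `|batch_mean w - v| ^+ 2)%:E)%E).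
  apply: ge0_le_integral => //.
  - by move=> w _; rewrite lee_fin.
  - exact: measurableT_comp.
  - by move=> w _; rewrite lee_fin.
rewrite integral_affine//.
rewrite integral_cst// [X in (_ * X)%E](probability_setT P) mule1 eg mule0
  adde0.
rewrite EFinD leeD2l//.
under eq_integral do rewrite EFinM.
by rewrite integralZl// EFinM lee_wpmul2l// lee_fin.
Qed.

End Batch.

(** * Affine bounds for the tilted exponentials *)

Section ExpBounds.
Context {R : realType} {H : completeNormedModType R} (dot : {dot H for idfun}).
Hypothesis dot_norm : forall x : H, dot x x = `|x| ^+ 2.
Variables (v ub : H) (L e l D w t c : R).
Hypotheses (vL : `|v| <= L) (e0 : 0 < e) (L0 : 0 < L) (Ll : (1 + e) * L <= l)
  (D0 : 0 <= D) (w0 : 0 <= w) (t0 : 0 <= t) (tc : t * c < 3).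

Let l0 : 0 < l.
Proof. by apply: lt_le_trans Ll; rewrite mulr_gt0// addr_gt0. Qed.

Let vl : `|v| <= l.
Proof.
apply: le_trans vL (le_trans _ Ll); rewrite ler_peMl ?(ltW L0)//.
by rewrite lerDl ltW.
Qed.

Let kap : R := t ^+ 2 / (2 * (1 - t * c / 3)).

Let kap0 : 0 <= kap.
Proof.
rewrite divr_ge0 ?sqr_ge0// mulr_ge0// subr_ge0 ler_pdivrMr// mul1r.
exact: ltW.
Qed.

Lemma expR_tilt_le (a : R) : a <= c -> expR (t * a) <= 1 + t * a + kap * a ^+ 2.
Proof.
move=> ac; have tac : t * a <= t * c by rewrite ler_wpM2l.
apply: (le_trans (expR_le_quadratic tac tc)).
by rewrite exprMn /kap mulrAC.
Qed.

(** [y] stands for x_k - x* and [a] for the gap, which enters only through [a <= dot v y]. With A =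
    <v - clip ub, y>, the linear term of the exponential uses the exact deviation plus the quadratic
    bias, the square uses |A| <= |ub - v| D, and the scale uses that both [v] and the clipped vector
    have norm at most [l]. *)
Lemma expR_clip_error_le (y : H) (a : R) : `|y| <= D -> 2 * D * (w * l) <= c ->
  a <= dot v y ->
  expR (t * (w * (a - dot (clip ub l) y))) <=
  1 + - (t * w) * dot (ub - v) y +
  (t * w * D * ((1 + 1 / e) / l) + kap * (w * D) ^+ 2) * `|ub - v| ^+ 2.
Proof.
move=> yD cD av; set A := dot (v - clip ub l) y.
have aA : a - dot (clip ub l) y <= A by rewrite /A dotDl dotNl lerD2r.
have An : `|A| <= `|ub - v| * D.
  apply: (le_trans (abs_dot_le_norm dot_norm _ _)).
  by rewrite ler_pM// distrC (clip_nonexpansive dot_norm).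
have Al : A <= 2 * l * D.
  apply: (le_trans (dot_le_norm dot_norm _ _)); rewrite ler_pM//.
  apply: (le_trans (ler_normB _ _)).
  by have := clip_le l0 ub; have := vl; lra.
have Ab : A <= - dot (ub - v) y + (1 + 1 / e) / l * `|ub - v| ^+ 2 * D.
  have -> : A = - dot (ub - v) y + dot (ub - clip ub l) y.
    by rewrite /A !dotE; ring.
  rewrite lerD2l (le_trans (dot_le_norm dot_norm _ _))// ler_pM//.
  apply: clip_bias => //; apply: le_trans Ll.
  by rewrite ler_wpM2l// addr_ge0// ltW.
have wA : w * A <= c.
  apply: le_trans cD; apply: (@le_trans _ _ (w * (2 * l * D))).
    by rewrite ler_wpM2l.
  by rewrite le_eqVlt; apply/orP; left; apply/eqP; ring.
apply: (@le_trans _ _ (expR (t * (w * A)))).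
  by rewrite ler_expR !ler_wpM2l.
apply: (le_trans (expR_tilt_le wA)).
have A2 : A ^+ 2 <= (`|ub - v| * D) ^+ 2.
  by rewrite -(real_normK (num_real A)) lerXn2r ?nnegrE ?mulr_ge0.
have h1 : t * (w * A) <= t * (w * (- dot (ub - v) y +
    (1 + 1 / e) / l * `|ub - v| ^+ 2 * D)) by rewrite !ler_wpM2l.
have h2 : kap * (w * A) ^+ 2 <= kap * (w ^+ 2 * (`|ub - v| * D) ^+ 2).
  by rewrite ler_wpM2l// exprMn ler_wpM2l// sqr_ge0.
apply: (@le_trans _ _ (1 + t * (w * (- dot (ub - v) y +
    (1 + 1 / e) / l * `|ub - v| ^+ 2 * D)) +
    kap * (w ^+ 2 * (`|ub - v| * D) ^+ 2))).
  by rewrite lerD// lerD2l.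
by rewrite le_eqVlt; apply/orP; left; apply/eqP; ring.
Qed.

(** The second argument of the minimum keeps [z] below [c]; the first one bounds [z] by a multiple
    of n^2, and also [z ^+ 2] after one factor n^2 is replaced by l^2. What is left is 1 + b |ub|^2,
    expanded around [v]. *)
Lemma expR_clip_step_le (g : R) : 0 <= g -> D * (w * l) <= c ->
  forall b, b = t * (w * g / 2) + kap * (w * g * l / 2) ^+ 2 ->
  expR (t * (w * Num.min (g * `|clip ub l| ^+ 2 / 2) (D * `|clip ub l|))) <=
  (1 + b * L ^+ 2) + 2 * b * dot (ub - v) v + b * `|ub - v| ^+ 2.
Proof.
move=> g0 Dc b bE; set n := `|clip ub l|; set z := w * _.
have n0 : 0 <= n by exact: normr_ge0.
have nl : n <= l by exact: clip_le.
have nu : n ^+ 2 <= `|ub| ^+ 2 by rewrite lerXn2r ?nnegrE// clip_le_norm.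
have zc : z <= c.
  apply: le_trans Dc; apply: (@le_trans _ _ (w * (D * n))).
    by rewrite ler_wpM2l// ge_min lexx orbT.
  by rewrite mulrCA !ler_wpM2l.
have z0 : 0 <= z.
  rewrite mulr_ge0// le_min (mulr_ge0 D0 n0) andbT.
  by rewrite divr_ge0// mulr_ge0// sqr_ge0.
have z1 : z <= w * g / 2 * n ^+ 2.
  have -> : w * g / 2 * n ^+ 2 = w * (g * n ^+ 2 / 2) by ring.
  by rewrite ler_wpM2l// ge_min lexx.
have wg0 : 0 <= w * g / 2 by rewrite divr_ge0// mulr_ge0.
have z2 : z ^+ 2 <= (w * g * l / 2) ^+ 2 * n ^+ 2.
  apply: (@le_trans _ _ ((w * g / 2 * n ^+ 2) ^+ 2)).
    by rewrite lerXn2r ?nnegrE// (le_trans z0).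
  have -> : (w * g / 2 * n ^+ 2) ^+ 2 = (w * g / 2) ^+ 2 * n ^+ 2 * n ^+ 2.
    by ring.
  have -> : (w * g * l / 2) ^+ 2 * n ^+ 2 = (w * g / 2) ^+ 2 * n ^+ 2 * l ^+ 2.
    by ring.
  rewrite ler_wpM2l ?lerXn2r ?nnegrE ?(ltW l0)//.
  by rewrite mulr_ge0 ?sqr_ge0.
have b0 : 0 <= b.
  rewrite bE; apply: addr_ge0; first exact: mulr_ge0.
  by rewrite mulr_ge0// sqr_ge0.
have vL2 : `|v| ^+ 2 <= L ^+ 2 by rewrite lerXn2r ?nnegrE// ltW.
apply: (le_trans (expR_tilt_le zc)).
apply: (@le_trans _ _ (1 + b * `|ub| ^+ 2)).
  rewrite -addrA lerD2l; apply: (@le_trans _ _ (b * n ^+ 2)).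
    by rewrite bE mulrDl lerD// -mulrA ler_wpM2l.
  by rewrite ler_wpM2l.
have eu : `|ub| ^+ 2 = `|ub - v| ^+ 2 + 2 * dot (ub - v) v + `|v| ^+ 2.
  by rewrite -(normD_sqr dot_norm) subrK.
have : b * `|v| ^+ 2 <= b * L ^+ 2 by rewrite ler_wpM2l.
by rewrite eu => ?; lra.
Qed.

End ExpBounds.

(* Solving the sub-gamma bound for the optimal tilt [t]; taking [c'] strictly
   larger than [c / 3] keeps [t] admissible even when [V = 0]. *)
Lemma bernstein_tilt (R : realType) (c c' V l : R) : 0 <= c -> c / 3 < c' ->
  0 <= V -> 0 < l ->
  exists t : R, [/\ 0 < t, t * c < 3 &
    t * V / (2 * (1 - t * c / 3)) + l / t <= Num.sqrt (2 * V * l) + c' * l].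
Proof.
move=> c0 cc' V0 l0.
have c'0 : 0 < c' by rewrite (le_lt_trans _ cc')// divr_ge0.
(* Without [c] and [c'] the optimal tilt would be [s^-1]. With [t = (c' + s)^-1] the first term
   becomes [V / (2 * (c' + s - c / 3))], at most [s * l] because [V = 2 * l * s ^+ 2], and [l / t]
   is [(c' + s) * l]. *)
pose s := Num.sqrt (V / (2 * l)).
have s0 : 0 <= s by exact: sqrtr_ge0.
have s2 : s ^+ 2 = V / (2 * l) by rewrite sqr_sqrtr// divr_ge0// mulr_ge0// ltW.
have VE : V = s ^+ 2 * (2 * l) by rewrite s2 divfK// mulf_neq0// gt_eqF.
have cs0 : 0 < c' + s by rewrite ltr_pwDl.
have t0 : 0 < (c' + s)^-1 by rewrite invr_gt0.
exists (c' + s)^-1; split => //.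
  by rewrite mulrC ltr_pdivrMr//; lra.
have -> : Num.sqrt (2 * V * l) = 2 * l * s.
  have -> : 2 * V * l = (2 * l * s) ^+ 2 by rewrite VE; ring.
  by rewrite sqrtr_sqr ger0_norm// !mulr_ge0// ltW.
have d0 : 0 < c' + s - c / 3 by lra.
have -> : (c' + s)^-1 * V / (2 * (1 - (c' + s)^-1 * c / 3)) =
    V / (2 * (c' + s - c / 3)).
  field; rewrite !gt_eqF//=; lra.
rewrite invrK.
suff : V / (2 * (c' + s - c / 3)) <= s * l by lra.
rewrite ler_pdivrMr; last by lra.
rewrite VE; have : 0 <= s * l * (c' - c / 3).
  by rewrite !mulr_ge0 ?(ltW l0)//; lra.
lra.
Qed.

(** * Exponential supermartingale and tail bounds *)

Section HistoryId.
Context {R : realType} {d dZ : measure_display} {Omega : measurableType d}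
  {Z : measurableType dZ} (P : probability Omega R) {I : choiceType}
  (Y : I -> {RV P >-> Z}).
Implicit Types J : set I.

(* Viewing the identity as a random variable with values in [Omega], equipped
   with the sigma-algebra of the past or of the current batch, makes the pair
   (past, batch) distributed as a product measure, so that conditioning on the
   past becomes Tonelli's theorem. *)
Definition history_id J : Omega -> history Y J := id.

Lemma measurable_history_id J : measurable_fun setT (history_id J).
Proof.
by move=> _ A sA; rewrite setTI; exact: (measurable_history (Y := Y) (J := J)).
Qed.

HB.instance Definition _ J := isMeasurableFun.Build _ _ _ _ (history_id J)
  (@measurable_history_id J).

Lemma measurable_history_rv J i : J i ->
  measurable_fun setT (Y i : history Y J -> Z).
Proof.
move=> Ji _ B mB; rewrite setTI.
by apply: sub_sigma_algebra; exact: cylinders_preimage.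
Qed.

Lemma measurable_sub_history J J' : J `<=` J' ->
  measurable_fun setT (id : history Y J' -> history Y J).
Proof. by move=> JJ' _ A sA; rewrite setTI; exact: (sub_history JJ'). Qed.

Lemma history_id_independent (D : set I) J1 J2 : mutually_independent D Y ->
  J1 `<=` D -> J2 `<=` D -> J1 `&` J2 = set0 ->
  independent_pair (P := P) (history_id J1) (history_id J2).
Proof.
move=> indY J1D J2D J12 A B sA sB.
exact: (history_independent indY J1D J2D J12).
Qed.

End HistoryId.

Section Supermartingale.
Context {R : realType} {H : completeNormedModType R}
  {d dZ : measure_display} {Omega : measurableType d} {Z : measurableType dZ}
  (P : probability Omega R) (X : set H) (m : nat)
  (xi_ : nat -> 'I_m -> {RV P >-> Z}).

Let D := [set kj : nat * 'I_m | (0 < kj.1)%N].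
Let Y (kj : nat * 'I_m) := xi_ kj.1 kj.2.
Hypothesis indY : mutually_independent D Y.

(** The iterate x_k is built from the batches before [k], hence the strict bound; index 0 is left
    out since independence is only known from batch 1 on. *)
Definition past (k : nat) := [set kj : nat * 'I_m | (0 < kj.1 < k)%N].
Definition now (k : nat) := [set kj : nat * 'I_m | kj.1 = k].

(** [mF] quantifies over the measurable space because it is used on the past alone, on the product
    of past and current batch, and on [Omega] with the iterate frozen. The bound in [Fb] is uniform
    over [X], so no conditional expectation has to be formed. *)
Variables (x : nat -> Omega -> H) (F : nat -> H -> ('I_m -> Z) -> R)
  (b : nat -> R) (N : nat).
Hypotheses (xX : forall k w, X (x k w))
  (mx : forall k, (0 < k)%N ->
    strongly_measurable setT (x k : history Y (past k) -> H))
  (F0 : forall k y z, 0 <= F k y z)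
  (mF : forall k d' (T : measurableType d') (y : T -> H) (z : 'I_m -> T -> Z),
    (0 < k)%N -> strongly_measurable setT y -> (forall t, X (y t)) ->
    (forall j, measurable_fun setT (z j)) ->
    measurable_fun setT (fun t => F k (y t) (z ^~ t)))
  (b0 : forall k, 0 <= b k)
  (Fb : forall k y, (0 < k <= N)%N -> X y ->
    (\int[P]_w (F k y (fun j => xi_ k j w))%:E <= (b k)%:E)%E).

(** Induction on the number of factors: the last one is integrated over the current batch with the
    past frozen, where [Fb] applies. *)
Lemma supermartingale_prod n : (n <= N)%N ->
  (\int[P]_w (\prod_(1 <= i < n.+1) F i (x i w) (fun j => xi_ i j w))%:E <=
   (\prod_(1 <= i < n.+1) b i)%:E)%E.
Proof.
elim: n => [_|n IH nN].
  under eq_integral do rewrite big_geq//.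
  by rewrite big_geq// integral_cst// [X in (_ * X)%E](probability_setT P)
    mule1.
have {}IH := IH (ltnW nN).
pose k := n.+1; pose T1 := history Y (past k); pose T2 := history Y (now k).
pose G (w : T1) : R := \prod_(1 <= i < k) F i (x i w) (fun j => xi_ i j w).
have mG : measurable_fun setT G.
  apply: measurable_prod => i; rewrite mem_index_iota => /andP[i1 ik].
  apply: mF => //.
    have sub : past i `<=` past k.
      by move=> kj /= /andP[k0 h]; apply/andP; split=> //; exact: ltn_trans h
        ik.
    exact: (strongly_measurable_comp (D' := setT) (@measurable_sub_history _ _
      _ Omega Z P _ Y _ _ sub)
      (fun _ _ => Logic.I) (mx i1)).
  by move=> j; apply: (measurable_history_rv (Y := Y) (i := (i, j)));
    exact/andP.
have G0 w : 0 <= G w by apply: prodr_ge0 => i _; exact: F0.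
pose Phi (z : T1 * T2) : R := G z.1 * F k (x k z.1) (fun j => xi_ k j z.2).
have mPhi : measurable_fun setT Phi.
  apply: measurable_funM; first exact: (measurableT_comp mG measurable_fst).
  apply: mF => //.
    exact: (strongly_measurable_comp (D' := setT) measurable_fst
      (fun _ _ => Logic.I) (mx _)).
  move=> j; apply: (measurableT_comp _ measurable_snd).
  exact: (measurable_history_rv (Y := Y) (i := (k, j))).
have Phi0 z : (0 <= (EFin \o Phi) z)%E by rewrite lee_fin mulr_ge0.
have ind : independent_pair (P := P) (history_id Y (past k)) (history_id Y (now
  k)).
  apply: (history_id_independent indY).
  - by move=> kj /= /andP[].
  - by move=> kj /= e; rewrite /D /= e.
  - by rewrite -subset0 => kj /= [/andP[_ +] e]; rewrite e ltnn.
have mPhiE : measurable_fun setT (EFin \o Phi) by exact: measurableT_comp.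
have e := integral_independent_pair ind mPhiE Phi0.
apply: (@le_trans _ _ (\int[P]_w (EFin \o Phi)
    (history_id Y (past k) w, history_id Y (now k) w))%E).
  rewrite le_eqVlt; apply/orP; left; apply/eqP.
  by apply: eq_integral => w _; rewrite /= big_nat_recr.
rewrite e big_nat_recr//= [X in (_ <= X)%E]EFinM muleC.
apply: (@le_trans _ _ (\int[P]_w ((b k)%:E * (G w)%:E))%E); last first.
  rewrite ge0_integralZl//.
  - by rewrite lee_wpmul2l// lee_fin.
  - apply: measurableT_comp => //.
    exact: (measurableT_comp mG (@measurable_history_id _ _ _ Omega Z P _ Y
      (past k))).
  - by move=> w _; rewrite lee_fin.
  - by rewrite lee_fin.
apply: ge0_le_integral => //.
- by move=> w _; apply: integral_ge0 => w' _; exact: Phi0.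
- exact: (measurable_integral_section (P := P) (history_id Y (past k))
    (history_id Y (now k)) mPhiE Phi0).
- apply: measurable_funeM; apply: measurableT_comp => //.
  exact: (measurableT_comp mG (@measurable_history_id _ _ _ Omega Z P _ Y (past
    k))).
move=> w _; rewrite /Phi/=; under eq_integral do rewrite EFinM.
rewrite ge0_integralZl//.
- by rewrite muleC lee_wpmul2r ?lee_fin ?Fb.
- apply: measurableT_comp => //; apply: mF => //.
    exact: strongly_measurable_cst.
- by move=> w' _; rewrite lee_fin; exact: F0.
- by rewrite lee_fin; exact: G0.
Qed.
End Supermartingale.

Lemma exp_tail (R : realType) d (T : measurableType d) (P : probability T R)
    (S : T -> R) (t beta B l : R) :
  measurable_fun setT S -> 0 < t ->
  (\int[P]_w (expR (t * S w))%:E <= (expR beta)%:E)%E -> beta + l <= t * B ->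
  (P [set w | (B < S w)%R] <= (expR (- l))%:E)%E.
Proof.
move=> mS t0 hS hB.
have mE : measurable_fun setT (fun w => (expR (t * S w))%:E).
  apply: measurableT_comp => //; apply: measurableT_comp => //.
  exact: measurable_funM.
(* Markov's inequality at the level [expR (t * B)]. *)
have h := @le_integral_comp_abse _ T R P setT measurableT _ (expR (t * B)) id
  (@measurable_id _ _ setT) (fun r r0 => r0) (fun x y _ _ xy => xy) mE
  (expR_gt0 _).
rewrite setTI in h.
have mB : measurable [set w | (B < S w)%R].
  have -> : [set w | B < S w] = S @^-1` `]B, +oo[.
    by apply/seteqP; split => w /=; rewrite in_itv /= andbT.
  by rewrite -[X in measurable X]setTI; exact: mS.
have sub : [set w | B < S w] `<=`
    [set w | ((expR (t * B))%:E <= `|(expR (t * S w))%:E|)%E].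
  move=> w /= Bw; rewrite lee_fin ger0_norm ?expR_ge0// ler_expR.
  by rewrite ler_wpM2l ?ltW.
have mE2 : measurable [set w | ((expR (t * B))%:E <= `|(expR (t * S w))%:E|)%E].
  have -> : [set w | ((expR (t * B))%:E <= `|(expR (t * S w))%:E|)%E] =
      S @^-1` `[B, +oo[.
    apply/seteqP; split => w /=; rewrite in_itv /= andbT.
      by rewrite lee_fin ger0_norm ?expR_ge0// ler_expR ler_pM2l.
    by rewrite lee_fin ger0_norm ?expR_ge0// ler_expR ler_pM2l.
  by rewrite -[X in measurable X]setTI; exact: mS.
have h2 : ((expR (t * B))%:E * P [set w | (B < S w)%R] <= (expR beta)%:E)%E.
  apply: (@le_trans _ _ ((expR (t * B))%:E *
      P [set w | ((expR (t * B))%:E <= `|(expR (t * S w))%:E|)%E])%E).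
    by rewrite lee_wpmul2l ?lee_fin ?expR_ge0// le_measure ?inE.
  apply: (le_trans h); apply: le_trans hS.
  rewrite le_eqVlt; apply/orP; left; apply/eqP; apply: eq_integral => w _ /=.
  by rewrite ger0_norm ?expR_ge0.
rewrite muleC -lee_pdivlMr ?expR_gt0// in h2; apply: (le_trans h2).
rewrite -EFinM lee_fin -expRN -expRD ler_expR; lra.
Qed.

Lemma telescope_weights_le (R : realType) (r a : nat -> R) (b : R) (k : nat) :
  (0 < k)%N -> (forall i, (0 < i)%N -> r i <= r i.+1) ->
  (forall i, 0 <= a i <= b) -> 0 <= r 1%N ->
  \sum_(1 <= i < k.+1) r i * (a i - a i.+1) <= r k * b.
Proof.
move=> k0 r_mono ab r1.
(* Keeping [a k.+1] in the bound makes the induction work: the next step needs exactly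
   [(r k.+1 - r k) * (b - a k.+1) >= 0]. *)
suff h : 0 <= r k /\ \sum_(1 <= i < k.+1) r i * (a i - a i.+1) <=
    r k * (b - a k.+1).
  case: h => rk h; apply: (le_trans h); rewrite ler_wpM2l// gerBl.
  by case/andP: (ab k.+1).
elim: k k0 => // -[|k] IH _.
  split=> //; rewrite big_nat1 ler_wpM2l// lerD2r.
  by case/andP: (ab 1%N).
have [rk {}IH] := IH isT; have rr := r_mono k.+1 isT.
split; first exact: le_trans rr.
rewrite big_nat_recr//=; apply: (le_trans (lerD IH (lexx _))).
have /andP[_ a2] := ab k.+2.
have : 0 <= (r k.+2 - r k.+1) * (b - a k.+2) by rewrite mulr_ge0 ?subr_ge0.
by move=> ?; lra.
Qed.

(** * Regret of the clipped method *)

Section Cssgm.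
Context {R : realType} {H : completeNormedModType R} (dot : {dot H for idfun}).
Hypothesis dot_norm : forall x : H, dot x x = `|x| ^+ 2.
Variables (X : set H) (f : H -> R) (L : R).
Hypotheses (X0 : X !=set0) (clX : closed X) (cX : convex_set X)
  (bX : bounded_set X) (L_gt0 : 0 < L)
  (fL : forall x y, `|f x - f y| <= L * `|x - y|).
Context {d dZ : measure_display} {Omega : measurableType d}
  {Z : measurableType dZ} (P : probability Omega R).
Variables (xi : {RV P >-> Z}) (u : H -> Z -> H) (sigma : R).
Hypothesis u_sub : stochastic_subgradient dot X f u xi sigma.
Variables (m : nat) (xi_ : nat -> 'I_m -> {RV P >-> Z}).
Hypotheses (m_gt0 : (0 < m)%N) (xi_iid : iid_copies xi xi_).
Variables (x1 : H) (e : R) (gam lam wt : nat -> R).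
Hypotheses (x1X : X x1) (e_gt0 : 0 < e)
  (gam_gt0 : forall i, (0 < i)%N -> 0 < gam i)
  (lam_ge : forall i, (1 + e) * L <= lam i)
  (wt_gt0 : forall i, (0 < i)%N -> 0 < wt i).

Let Y (kj : nat * 'I_m) := xi_ kj.1 kj.2.
Let x := cssgm X u gam lam x1 (fun k j => xi_ k j).
Let D := diameter X.
(** Bound on the second moment of the unclipped batch mean: its variance plus the squared norm of a
    subgradient. *)
Let S := sigma ^+ 2 / m%:R + L ^+ 2.

Lemma lam_gt0 i : 0 < lam i.
Proof. by apply: lt_le_trans (lam_ge i); rewrite mulr_gt0// addr_gt0. Qed.

Definition clipped_mean k (y : H) (z : 'I_m -> Z) : H :=
  clip (m%:R^-1 *: \sum_(j < m) u y (z j)) (lam k).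

Lemma strongly_measurable_clipped_mean k d' (T : measurableType d')
    (y : T -> H) (z : 'I_m -> T -> Z) :
  strongly_measurable setT y -> (forall t, X (y t)) ->
  (forall j, measurable_fun setT (z j)) ->
  strongly_measurable setT (fun t => clipped_mean k (y t) (z ^~ t)).
Proof.
move=> my yX mz.
have msum (r : seq 'I_m) :
    strongly_measurable setT (fun t => \sum_(j <- r) u (y t) (z j t)).
  elim: r => [|j r IH].
    under eq_fun do rewrite big_nil.
    exact: strongly_measurable_cst.
  under eq_fun do rewrite big_cons.
  apply: (@strongly_measurable_op2 _ H H H _ _ _ (fun a b => a + b) _ _ _ _ IH).
    by move=> a b v w av bw; exact: cvgD.
  exact: (jointly_measurable_comp (proj1 u_sub)).
have mscale := @strongly_measurable_op1 _ H H _ _ _ (fun a => m%:R^-1 *: a) _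
  (@scaler_continuous _ _ _) (msum (index_enum _)).
exact: (@strongly_measurable_op1 _ H H _ _ _ (fun a => clip a (lam k)) _
  (continuous_clip (lam_gt0 k)) mscale).
Qed.

Lemma cssgm_in k w : X (x k w).
Proof.
case: k => [//|[//|k]].
exact: (projection_in dot_norm X0 clX cX bX).
Qed.

Lemma cssgmS k w : (0 < k)%N -> x k.+1 w =
  projection X (x k w - gam k *: clipped_mean k (x k w) (fun j => xi_ k j w)).
Proof. by case: k. Qed.

(** Adaptedness of the iterates, which allows [supermartingale_prod] to freeze them. *)
Lemma strongly_measurable_cssgm k : (0 < k)%N ->
  strongly_measurable setT (x k : history Y (past k) -> H).
Proof.
elim: k => // -[|k] IH _; first exact: strongly_measurable_cst.
set T := history Y (past k.+2).
have sub : @past m k.+1 `<=` past k.+2.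
  by move=> kj /= /andP[k0 h]; apply/andP; split=> //; exact: ltn_trans h _.
have mxk : strongly_measurable setT (x k.+1 : T -> H).
  exact: (strongly_measurable_comp (D' := setT)
    (@measurable_sub_history _ _ _ Omega Z P _ Y _ _ sub)
    (fun _ _ => Logic.I) (IH isT)).
have mxi j : measurable_fun setT (xi_ k.+1 j : T -> Z).
  apply: (measurable_history_rv (Y := Y) (i := (k.+1, j))).
  by apply/andP; split.
have mclip := strongly_measurable_clipped_mean k.+1 mxk (cssgm_in k.+1) mxi.
have mstep : strongly_measurable setT (fun w : T => x k.+1 w -
    gam k.+1 *: clipped_mean k.+1 (x k.+1 w) (fun j => xi_ k.+1 j w)).
  apply: (@strongly_measurable_op2 _ H H H _ _ _
    (fun a b => a - gam k.+1 *: b) _ _ _ mxk mclip).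
  by move=> a b v w av bw; apply: cvgB => //; exact: cvgZl_tmp.
exact: (@strongly_measurable_op1 _ H H _ _ _ _ _
  (continuous_projection dot_norm X0 clX cX bX) mstep).
Qed.

Lemma subgradient_exists y : X y -> exists v, subdifferential dot f y v.
Proof. by move=> /(proj2 u_sub)[v [_ ? _]]; exists v. Qed.

Variable xs : H.
Hypothesis xsX : X xs.

(* Using [f y - f xs] instead of the product with the mean subgradient avoids
   the measurability in [y] of the expectation of [u y xi]. *)
Definition regret k (y : H) (z : 'I_m -> Z) : R :=
  wt k * (f y - f xs - dot (clipped_mean k y z) (y - xs)).

(* The consecutive iterates lie in [X], which gives the second argument of the
   minimum. With the first one alone, Bernstein's inequality would involve
   [wt k * gam k * lam k ^+ 2], which is too large at small [k] when
   [p < 1 / 2]. *)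
Definition drift k (y : H) (z : 'I_m -> Z) : R :=
  wt k * Num.min (gam k * `|clipped_mean k y z| ^+ 2 / 2)
                 (D * `|clipped_mean k y z|).

Lemma D_ge0 : 0 <= D.
Proof. by apply: le_trans (diameter_le bX xsX xsX). Qed.

Lemma S_ge0 : 0 <= S.
Proof. by rewrite addr_ge0 ?divr_ge0 ?sqr_ge0. Qed.

Lemma lipschitz_continuous : continuous f.
Proof. exact: (@lipschitz_cvg_continuous _ _ R^o f L). Qed.

Lemma measurable_regret k d' (T : measurableType d') (y : T -> H)
    (z : 'I_m -> T -> Z) :
  (0 < k)%N -> strongly_measurable setT y -> (forall t, X (y t)) ->
  (forall j, measurable_fun setT (z j)) ->
  measurable_fun setT (fun t => regret k (y t) (z ^~ t)).
Proof.
move=> k0 my yX mz; have mc := strongly_measurable_clipped_mean k my yX mz.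
apply: measurable_funM => //; apply: measurable_funB.
  apply: measurable_funB => //; apply: strongly_measurable_fun.
  exact: (@strongly_measurable_op1 _ H R^o _ _ _ f _ lipschitz_continuous my).
apply: strongly_measurable_fun.
apply: (@strongly_measurable_op2 _ H H R^o _ _ _ (fun a b => dot a (b - xs))
  _ _ _ mc my).
move=> a b v w av bw; apply: (cvg_dot dot_norm) => //.
by apply: cvgB => //; exact: cvg_cst.
Qed.

Lemma measurable_drift k d' (T : measurableType d') (y : T -> H)
    (z : 'I_m -> T -> Z) :
  (0 < k)%N -> strongly_measurable setT y -> (forall t, X (y t)) ->
  (forall j, measurable_fun setT (z j)) ->
  measurable_fun setT (fun t => drift k (y t) (z ^~ t)).
Proof.
move=> k0 my yX mz; have mc := strongly_measurable_clipped_mean k my yX mz.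
have mn : measurable_fun setT (fun t => `|clipped_mean k (y t) (z ^~ t)|).
  apply: strongly_measurable_fun.
  exact: (@strongly_measurable_op1 _ H R^o _ _ _ (fun a => `|a|) _
    (@norm_continuous _ _) mc).
apply: measurable_funM => //; apply: measurable_minr.
  by do 2! apply: measurable_funM => //; exact: measurable_funX.
exact: measurable_funM.
Qed.

Lemma batch_le k y (Phi : Omega -> R) (a0 a1 a2 : R) (z v : H) :
  (0 < k)%N -> X y ->
  is_expectation P dot (fun w => u y (xi w)) v ->
  ('E_P[fun w => (`|u y (xi w) - v| ^+ 2)%R] <= (sigma ^+ 2)%:E)%E ->
  measurable_fun setT Phi -> (forall w, 0 <= Phi w) -> 0 <= a2 ->
  (forall w, let ub := m%:R^-1 *: \sum_(j < m) u y (xi_ k j w) in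
    Phi w <= a0 + a1 * dot (ub - v) z + a2 * `|ub - v| ^+ 2) ->
  (\int[P]_w (Phi w)%:E <= (a0 + a2 * (sigma ^+ 2 / m%:R))%:E)%E.
Proof.
move=> k0 yX ev; rewrite unlock => var mPhi Phi0 a20 hPhi.
have [ind law] := xi_iid.
have mu : strongly_measurable setT (u y).
  exact: (jointly_measurable_comp (proj1 u_sub) (strongly_measurable_cst _ y)).
apply: (integral_batch_le dot_norm mu ev var (zeta := xi_ k) _ _ _ mPhi Phi0
  a20 hPhi).
- by move=> j B mB; exact: law.
- move=> i j ij A B mA mB.
  have := ind [fset (k, i); (k, j)]%fset
    (fun kj => if kj == (k, i) then A else B).
  have kij : (k, i) != (k, j) by rewrite xpair_eqE eqxx.
  rewrite big_fsetU1 ?inE//= big_seq_fset1 eqxx [(k, j) == _]eq_sym (negbTE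
    kij).
  move=> <-.
  + congr (P _); apply/seteqP; split => [w [Aw Bw] kl /=|w h].
      by rewrite !inE => /orP[] /eqP -> /=; rewrite ?eqxx// eq_sym (negbTE kij).
    split; first by have := h (k, i); rewrite /= !inE eqxx => /(_ isT).
    by have := h (k, j); rewrite /= !inE eqxx orbT eq_sym (negbTE kij) => /(_
      isT).
  + by move=> kl /=; rewrite !inE => /orP[] /eqP -> /=.
  + by move=> kl; case: ifP.
- exact: m_gt0.
Qed.

(** Bernstein's inequality for adapted terms with deterministic mean bounds [mu] and variance
    proxies [nu]. The exponential bound is assumed for every admissible [t], since the tilt depends
    on the total of [nu]. *)
Lemma sum_tail (G : nat -> H -> ('I_m -> Z) -> R) (mu nu : nat -> R)
    (c c' l : R) (n : nat) :
  (forall k d' (T : measurableType d') (y : T -> H) (z : 'I_m -> T -> Z),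
    (0 < k)%N -> strongly_measurable setT y -> (forall t, X (y t)) ->
    (forall j, measurable_fun setT (z j)) ->
    measurable_fun setT (fun t => G k (y t) (z ^~ t))) ->
  0 <= c -> c / 3 < c' -> 0 < l -> (forall i, 0 <= nu i) ->
  (forall t k y, 0 <= t -> t * c < 3 -> (0 < k <= n)%N -> X y ->
    (\int[P]_w (expR (t * G k y (fun j => xi_ k j w)))%:E <=
     (expR (t * mu k + t ^+ 2 / (2 * (1 - t * c / 3)) * nu k))%:E)%E) ->
  (P [set w | (\sum_(1 <= i < n.+1) mu i
      + Num.sqrt (2 * (\sum_(1 <= i < n.+1) nu i) * l) + c' * l <
      \sum_(1 <= i < n.+1) G i (x i w) (fun j => xi_ i j w))%R]
    <= (expR (- l))%:E)%E.
Proof.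
move=> mG c0 cc' l0 nu0 mgf.
set V := \sum_(1 <= i < n.+1) nu i.
have V0 : 0 <= V by apply: sumr_ge0.
have [t [t0 tc ht]] := bernstein_tilt c0 cc' V0 l0.
set K := t ^+ 2 / (2 * (1 - t * c / 3)).
have mx k : (0 < k)%N -> strongly_measurable setT (x k : Omega -> H).
  move=> k0; exact: (strongly_measurable_comp (D' := setT)
    (@measurable_history_id _ _ _ Omega Z P _ Y _)
    (fun _ _ => Logic.I) (strongly_measurable_cssgm k0)).
apply: (@exp_tail _ _ _ _ _ t (t * (\sum_(1 <= i < n.+1) mu i) + K * V)) => //.
- under eq_fun do rewrite big_add1/=.
  apply: measurable_sum => i.
  by apply: mG => //; [exact: mx|exact: cssgm_in].
- under eq_integral => w _ do rewrite mulr_sumr expR_sum.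
  have -> : expR (t * (\sum_(1 <= i < n.+1) mu i) + K * V) =
      \prod_(1 <= i < n.+1) expR (t * mu i + K * nu i).
    by rewrite -expR_sum big_split/= -!mulr_sumr.
  have [indY _] := xi_iid.
  apply: (@supermartingale_prod _ _ _ _ _ _ _ X m xi_ indY x
    (fun k y z => expR (t * G k y z)) _ n) => //.
  + exact: cssgm_in.
  + exact: strongly_measurable_cssgm.
  + move=> k d' T y z k0 my yX mz; apply: measurableT_comp => //.
    by apply: measurable_funM => //; exact: mG.
  + by move=> k y kn yX; apply: mgf => //; exact: ltW.
- have h : t * (t * V / (2 * (1 - t * c / 3)) + l / t) <=
      t * (Num.sqrt (2 * V * l) + c' * l) by rewrite ler_wpM2l// ltW.
  have eK : t * (t * V / (2 * (1 - t * c / 3)) + l / t) = K * V + l.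
    by rewrite mulrDr [t * (l / t)]mulrC divfK ?gt_eqF// /K; congr (_ + _);
      ring.
  by rewrite eK in h; lra.
Qed.

(** The mean bound is the clipping bias, of order the batch variance over [lam k]; the variance
    proxy is that of [wt k * D] times the deviation of the batch mean. *)
Lemma mgf_regret t c k y : 0 <= t -> t * c < 3 -> (0 < k)%N -> X y ->
  2 * D * (wt k * lam k) <= c ->
  (\int[P]_w (expR (t * regret k y (fun j => xi_ k j w)))%:E <=
   (expR (t * (wt k * D * ((1 + 1 / e) / lam k) * (sigma ^+ 2 / m%:R)) +
     t ^+ 2 / (2 * (1 - t * c / 3)) * ((wt k * D) ^+ 2 * (sigma ^+ 2 /
       m%:R))))%:E)%E.
Proof.
move=> t0 tc k0 yX cD.
have [v [ev vsub var]] := proj2 u_sub y yX.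
have vL := subgradient_norm_le dot_norm (ltW L_gt0) fL vsub.
have wt0 := ltW (wt_gt0 k0).
set a2 := t * wt k * D * ((1 + 1 / e) / lam k) +
  t ^+ 2 / (2 * (1 - t * c / 3)) * (wt k * D) ^+ 2.
have a20 : 0 <= a2.
  apply: addr_ge0.
    rewrite !mulr_ge0 ?D_ge0 ?invr_ge0 ?(ltW (lam_gt0 k))//.
    by rewrite addr_ge0// divr_ge0// ltW.
  by rewrite mulr_ge0 ?sqr_ge0// divr_ge0 ?sqr_ge0//; lra.
have mR : measurable_fun setT (fun w => expR (t * regret k y (fun j => xi_ k j
  w))).
  apply: measurableT_comp => //; apply: measurable_funM => //.
  by apply: measurable_regret => //; exact: strongly_measurable_cst.
apply: (le_trans (batch_le (a0 := 1) (a1 := - (t * wt k)) (a2 := a2)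
  (z := y - xs) k0 yX ev var mR _ a20 _)).
- by move=> w; exact: expR_ge0.
- move=> w; have yD : `|y - xs| <= D by exact: diameter_le.
  have cD' : 2 * D * (wt k * lam k) <= c by [].
  have av : f y - f xs <= dot v (y - xs).
    by have := vsub xs; rewrite -opprB dotNl dotC => ?; lra.
  exact: (expR_clip_error_le dot_norm _ vL e_gt0 L_gt0 (lam_ge k)
    D_ge0 wt0 t0 tc yD cD' av).
rewrite lee_fin; apply: (le_trans (expR_ge1Dx _)); rewrite ler_expR.
rewrite /a2 mulrDl; apply: lerD; rewrite le_eqVlt; apply/orP; left; apply/eqP;
  ring.
Qed.

Lemma mgf_drift t c k y : 0 <= t -> t * c < 3 -> (0 < k)%N -> X y ->
  D * (wt k * lam k) <= c ->
  (\int[P]_w (expR (t * drift k y (fun j => xi_ k j w)))%:E <=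
   (expR (t * (wt k * gam k / 2 * S) +
     t ^+ 2 / (2 * (1 - t * c / 3)) * ((wt k * gam k * lam k / 2) ^+ 2 *
       S)))%:E)%E.
Proof.
move=> t0 tc k0 yX cD.
have [v [ev vsub var]] := proj2 u_sub y yX.
have vL := subgradient_norm_le dot_norm (ltW L_gt0) fL vsub.
have wt0 := ltW (wt_gt0 k0).
have gam0 := ltW (gam_gt0 k0).
set K := t ^+ 2 / (2 * (1 - t * c / 3)).
have K0 : 0 <= K by rewrite divr_ge0 ?sqr_ge0//; lra.
set b := t * (wt k * gam k / 2) + K * (wt k * gam k * lam k / 2) ^+ 2.
have b0 : 0 <= b.
  apply: addr_ge0; last by rewrite mulr_ge0// sqr_ge0.
  by rewrite mulr_ge0// divr_ge0// mulr_ge0.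
have mR : measurable_fun setT (fun w => expR (t * drift k y (fun j => xi_ k j
  w))).
  apply: measurableT_comp => //; apply: measurable_funM => //.
  by apply: measurable_drift => //; exact: strongly_measurable_cst.
apply: (le_trans (batch_le (a0 := 1 + b * L ^+ 2) (a1 := 2 * b) (a2 := b)
  (z := v) k0 yX ev var mR _ b0 _)).
- by move=> w; exact: expR_ge0.
- move=> w; exact: (expR_clip_step_le dot_norm _ vL e_gt0 L_gt0 (lam_ge k)
    D_ge0 wt0 t0 tc gam0 cD erefl).
(* The constant [b * L ^+ 2] and the variance term add up to [b * S]. *)
rewrite lee_fin; apply: (@le_trans _ _ (1 + b * S)).
  by rewrite /S le_eqVlt; apply/orP; left; apply/eqP; ring.
apply: (le_trans (expR_ge1Dx _)); rewrite ler_expR.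
by rewrite /b mulrDl !mulrA.
Qed.

Lemma regret_decomposition n w : (0 < n)%N ->
  (forall i, (0 < i)%N -> wt i / gam i <= wt i.+1 / gam i.+1) ->
  \sum_(1 <= i < n.+1) wt i * (f (x i w) - f xs) <=
  wt n / gam n * (D ^+ 2 / 2)
  + \sum_(1 <= i < n.+1) regret i (x i w) (fun j => xi_ i j w)
  + \sum_(1 <= i < n.+1) drift i (x i w) (fun j => xi_ i j w).
Proof.
move=> n0 mono.
pose a i := `|x i w - xs| ^+ 2 / 2.
have ab i : 0 <= a i <= D ^+ 2 / 2.
  rewrite divr_ge0 ?sqr_ge0//= ler_pM2r// lerXn2r ?nnegrE ?D_ge0//.
  by apply: diameter_le => //; exact: cssgm_in.
have r1 : 0 <= wt 1%N / gam 1%N by rewrite divr_ge0 ?ltW ?wt_gt0 ?gam_gt0.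
have tel := telescope_weights_le n0 mono ab r1.
have step i : (0 < i)%N -> wt i * (f (x i w) - f xs) <=
    wt i / gam i * (a i - a i.+1) + (regret i (x i w) (fun j => xi_ i j w)
    + drift i (x i w) (fun j => xi_ i j w)).
  move=> i0; have g0 := gam_gt0 i0; have w0 := wt_gt0 i0.
  have := projection_step dot_norm X0 clX cX bX
    (clipped_mean i (x i w) (fun j => xi_ i j w)) (ltW g0) (cssgm_in i w) xsX.
  rewrite -cssgmS// => h.
  have wg : 0 <= wt i / gam i by rewrite divr_ge0 ?ltW.
  have wgK z : wt i / gam i * (gam i * z) = wt i * z.
    by rewrite mulrA divfK ?gt_eqF.
  have {h} := ler_wpM2l wg h; rewrite mulrDr !wgK mulrA => h.
  have -> : wt i / gam i * (a i - a i.+1) = wt i / gam i *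
    (`|x i w - xs| ^+ 2 - `|x i.+1 w - xs| ^+ 2) / 2 by rewrite /a; ring.
  by rewrite /regret /drift mulrBr; lra.
apply: (le_trans (ler_sum_nat (fun i (hi : (1 <= i < n.+1)%N) =>
  step i (proj1 (andP hi))))).
by rewrite !big_split/= -addrA lerD2r.
Qed.

(** Outside two tail events, each of probability at most [expR (- l)], the decomposition and
    Jensen's inequality give the bound. [cA'] and [cZ'] are distinguished from [cA / 3] and [cZ / 3]
    because [bernstein_tilt] asks for a strict gap. *)
Theorem regret_bound (l cA cZ cA' cZ' B : R) (n : nat) :
  (0 < n)%N -> 0 < l ->
  (forall i, (0 < i)%N -> wt i / gam i <= wt i.+1 / gam i.+1) ->
  0 <= cA -> 0 <= cZ -> cA / 3 < cA' -> cZ / 3 < cZ' ->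
  (forall i, (0 < i <= n)%N -> 2 * D * (wt i * lam i) <= cA) ->
  (forall i, (0 < i <= n)%N -> D * (wt i * lam i) <= cZ) ->
  wt n / gam n * (D ^+ 2 / 2)
  + (\sum_(1 <= i < n.+1) wt i * D * ((1 + 1 / e) / lam i) * (sigma ^+ 2 / m%:R)
     + Num.sqrt (2 * (\sum_(1 <= i < n.+1) (wt i * D) ^+ 2 * (sigma ^+ 2 /
       m%:R)) * l)
     + cA' * l)
  + (\sum_(1 <= i < n.+1) wt i * gam i / 2 * S
     + Num.sqrt (2 * (\sum_(1 <= i < n.+1) (wt i * gam i * lam i / 2) ^+ 2 * S)
       * l)
     + cZ' * l) <= B ->
  ((1 - 2 * expR (- l))%:E <=
   P [set w | ((\sum_(1 <= i < n.+1) wt i) *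
       (f (weighted_average wt x n w) - f xs) <= B)%R])%E.
Proof.
move=> n0 l0 mono cA0 cZ0 cAA' cZZ' hA hZ.
set BA := (_ + _ + cA' * l); set BZ := (_ + _ + cZ' * l) => hB.
have sm0 : 0 <= sigma ^+ 2 / m%:R by rewrite divr_ge0 ?sqr_ge0.
have tA := sum_tail (G := regret) (n := n)
  (mu := fun i => wt i * D * ((1 + 1 / e) / lam i) * (sigma ^+ 2 / m%:R))
  (nu := fun i => (wt i * D) ^+ 2 * (sigma ^+ 2 / m%:R))
  measurable_regret cA0 cAA' l0
  (fun i => mulr_ge0 (sqr_ge0 _) sm0)
  (fun t k y t0 tc kn yX => mgf_regret t0 tc (proj1 (andP kn)) yX (hA k kn)).
have tZ := sum_tail (G := drift) (n := n) (mu := fun i => wt i * gam i / 2 * S)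
  (nu := fun i => (wt i * gam i * lam i / 2) ^+ 2 * S)
  measurable_drift cZ0 cZZ' l0
  (fun i => mulr_ge0 (sqr_ge0 _) S_ge0)
  (fun t k y t0 tc kn yX => mgf_drift t0 tc (proj1 (andP kn)) yX (hZ k kn)).
rewrite -/BA in tA; rewrite -/BZ in tZ.
set EA := [set w | _] in tA; set EZ := [set w | _] in tZ.
set E := [set w | _].
have mx k : (0 < k)%N -> strongly_measurable setT (x k : Omega -> H).
  move=> k0; exact: (strongly_measurable_comp (D' := setT)
    (@measurable_history_id _ _ _ Omega Z P _ Y _)
    (fun _ _ => Logic.I) (strongly_measurable_cssgm k0)).
have mavg : strongly_measurable setT (weighted_average wt x n).
  have msum : strongly_measurable setT
      (fun w => \sum_(0 <= i < n) wt i.+1 *: x i.+1 w).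
    elim: (n) => [|j IH].
      under eq_fun do rewrite big_geq//.
      exact: strongly_measurable_cst.
    under eq_fun do rewrite big_nat_recr//=.
    apply: (@strongly_measurable_op2 _ H H H _ _ _ (fun a b => a + wt j.+1 *: b)
      _ _ _ IH (mx j.+1 isT)).
    by move=> a b v w av bw; apply: cvgD => //; exact: cvgZl_tmp.
  have -> : weighted_average wt x n =
      (fun a => (\sum_(1 <= i < n.+1) wt i)^-1 *: a) \o
      (fun w => \sum_(0 <= i < n) wt i.+1 *: x i.+1 w).
    apply/funext => w /=; rewrite /weighted_average.
    by rewrite [X in _ *: X]big_add1.
  exact: (@strongly_measurable_op1 _ H H _ _ _ _ _
    (@scaler_continuous _ _ _) msum).
have mE : measurable E.
  pose h w := (\sum_(1 <= i < n.+1) wt i) * (f (weighted_average wt x n w) - f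
    xs).
  have mh : measurable_fun setT h.
    apply: measurable_funM => //; apply: measurable_funB => //.
    apply: strongly_measurable_fun.
    exact: (@strongly_measurable_op1 _ H R^o _ _ _ f _ lipschitz_continuous
      mavg).
  have -> : E = h @^-1` `]-oo, B].
    by apply/seteqP; split => w /=; rewrite in_itv.
  by rewrite -[X in measurable X]setTI; exact: mh.
have mG (G : nat -> H -> ('I_m -> Z) -> R) (b : R) :
    (forall k d' (T : measurableType d') (y : T -> H) (z : 'I_m -> T -> Z),
    (0 < k)%N -> strongly_measurable setT y -> (forall t, X (y t)) ->
    (forall j, measurable_fun setT (z j)) ->
    measurable_fun setT (fun t => G k (y t) (z ^~ t))) ->
    measurable [set w | b < \sum_(1 <= i < n.+1) G i (x i w) (fun j => xi_ i j
      w)].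
  move=> hG.
  pose h w := \sum_(0 <= i < n) G i.+1 (x i.+1 w) (fun j => xi_ i.+1 j w).
  have mh : measurable_fun setT h.
    apply: measurable_sum => i.
    by apply: hG => //; [exact: mx|exact: cssgm_in].
  have -> : [set w | b < \sum_(1 <= i < n.+1) G i (x i w) (fun j => xi_ i j w)]
      = h @^-1` `]b, +oo[.
    by apply/seteqP; split => w /=; rewrite in_itv /= andbT big_add1.
  by rewrite -[X in measurable X]setTI; exact: mh.
have mEA : measurable EA by apply: mG; exact: measurable_regret.
have mEZ : measurable EZ by apply: mG; exact: measurable_drift.
have sub : ~` E `<=` EA `|` EZ.
  move=> w /= /negP; rewrite -ltNge => hw.
  have [hA'|hA'] := ltP BA (\sum_(1 <= i < n.+1) regret i (x i w) (fun j => xi_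
    i j w)).
    by left.
  have [hZ'|hZ'] := ltP BZ (\sum_(1 <= i < n.+1) drift i (x i w) (fun j => xi_
    i j w)).
    by right.
  exfalso; move: hw; apply/negP; rewrite -leNgt.
  have dec := regret_decomposition w n0 mono.
  have avg := average_le cX wt_gt0 (x := fun i => x i w) n0
    (fun i _ => cssgm_in i w) subgradient_exists.
  rewrite mulrBr; apply: (@le_trans _ _
      (\sum_(1 <= i < n.+1) wt i * (f (x i w) - f xs))).
    under [leRHS]eq_bigr do rewrite mulrBr.
    by rewrite [leRHS]big_split/= sumrN -mulr_suml lerD2r.
  by apply: le_trans hB; apply: (le_trans dec); rewrite lerD// lerD2l.
have PE : (P (~` E) <= (2 * expR (- l))%:E)%E.
  apply: (@le_trans _ _ (P (EA `|` EZ))).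
    by rewrite le_measure ?inE//; [exact: measurableC|exact: measurableU].
  apply: (le_trans (measureU2 _ mEA mEZ)).
  have -> : 2 * expR (- l) = expR (- l) + expR (- l) by ring.
  by rewrite EFinD; apply: leeD.
rewrite probability_setC// in PE.
have PEfin : P E \is a fin_num by exact: fin_num_measure.
move: PE; rewrite -(fineK PEfin) -EFinB !lee_fin => ?; lra.
Qed.

End Cssgm.

(** * Choice of the parameters *)

(* The two copies of [gamma * beta ^+ 2 * M / 3] are the slack [c' - c / 3]
   required by [bernstein_tilt], paid for by the term [2 / 3 * betabar ^+ 2]
   of the bound. *)
Lemma regret_bound_le (R : realType) (n m : nat) (wt gam lam : nat -> R)
    (D sigma S e beta s gamma M c1 c2 c3 kappa : R) :
  0 <= D -> 0 <= sigma -> 0 < e -> 0 < beta -> 0 < s -> 0 < gamma -> 0 <= M ->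
  0 <= kappa -> 0 <= c2 -> (0 < m)%N -> 0 <= S ->
  \sum_(1 <= i < n.+1) wt i / lam i <= c3 * M / beta ->
  \sum_(1 <= i < n.+1) wt i ^+ 2 <= c2 ^+ 2 * M ^+ 2 ->
  \sum_(1 <= i < n.+1) wt i * gam i <= 2 * c1 * gamma * M ->
  \sum_(1 <= i < n.+1) (wt i * gam i * lam i) ^+ 2 <=
    2 * (gamma * beta * kappa * M) ^+ 2 ->
  M / gamma * (D ^+ 2 / 2)
  + (\sum_(1 <= i < n.+1) wt i * D * ((1 + 1 / e) / lam i) * (sigma ^+ 2 / m%:R)
     + Num.sqrt (2 * (\sum_(1 <= i < n.+1) (wt i * D) ^+ 2 * (sigma ^+ 2 /
       m%:R))
         * s ^+ 2)
     + (2 * D * (beta * M) / 3 + gamma * beta ^+ 2 * M / 3) * s ^+ 2)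
  + (\sum_(1 <= i < n.+1) wt i * gam i / 2 * S
     + Num.sqrt (2 * (\sum_(1 <= i < n.+1) (wt i * gam i * lam i / 2) ^+ 2 * S)
         * s ^+ 2)
     + (D * (beta * M) / 3 + gamma * beta ^+ 2 * M / 3) * s ^+ 2) <=
  M * (D ^+ 2 / (2 * gamma)
    + gamma * (2 / 3 * (beta * s) ^+ 2 + kappa * (beta * s) * Num.sqrt S + c1 *
      S)
    + D * (4 / 3 * (beta * s) + (1 + 1 / e) * (c2 * (4 * sigma / Num.sqrt (2 *
      m%:R))
        + c3 * (sigma ^+ 2 / (m%:R * (beta * s))))) * s).
Proof.
move=> D0 sig0 e0 b0 s0 g0 M0 k0 c20 m0 S0 h1 h2 h3 h4.
have m0' : 0 < m%:R :> R by rewrite ltr0n.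
have e1 : 0 <= 1 + 1 / e by rewrite addr_ge0// divr_ge0// ltW.
set q := sigma ^+ 2 / m%:R.
have q0 : 0 <= q by rewrite divr_ge0 ?sqr_ge0.
have T1 : \sum_(1 <= i < n.+1) wt i * D * ((1 + 1 / e) / lam i) * q <=
    M * (D * ((1 + 1 / e) * (c3 * (sigma ^+ 2 / (m%:R * (beta * s))))) * s).
  have -> : \sum_(1 <= i < n.+1) wt i * D * ((1 + 1 / e) / lam i) * q =
      D * (1 + 1 / e) * q * \sum_(1 <= i < n.+1) wt i / lam i.
    by rewrite mulr_sumr; apply: eq_bigr => i _; ring.
  apply: (@le_trans _ _ (D * (1 + 1 / e) * q * (c3 * M / beta))).
    by rewrite ler_wpM2l// !mulr_ge0.
  rewrite /q le_eqVlt; apply/orP; left; apply/eqP; field.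
  by rewrite !gt_eqF.
set r2m := Num.sqrt (2 * m%:R).
have r2m0 : 0 < r2m by rewrite sqrtr_gt0 mulr_gt0.
have r2mE : r2m ^+ 2 = 2 * m%:R by rewrite sqr_sqrtr// mulr_ge0// ltW.
have T2 : Num.sqrt (2 * (\sum_(1 <= i < n.+1) (wt i * D) ^+ 2 * q) * s ^+ 2) <=
    M * (D * ((1 + 1 / e) * (c2 * (4 * sigma / r2m))) * s).
  have Y0 : 0 <= M * (D * (c2 * (4 * sigma / r2m)) * s).
    by rewrite !mulr_ge0 ?invr_ge0 ?(ltW s0) ?(ltW r2m0).
  apply: (@le_trans _ _ (M * (D * (c2 * (4 * sigma / r2m)) * s))); last first.
    have -> : M * (D * ((1 + 1 / e) * (c2 * (4 * sigma / r2m))) * s) =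
      (1 + 1 / e) * (M * (D * (c2 * (4 * sigma / r2m)) * s)) by ring.
    by rewrite ler_peMl// lerDl divr_ge0// ltW.
  rewrite -[leRHS](ger0_norm Y0) -sqrtr_sqr ler_wsqrtr//.
  have -> : \sum_(1 <= i < n.+1) (wt i * D) ^+ 2 * q =
      D ^+ 2 * q * \sum_(1 <= i < n.+1) wt i ^+ 2.
    by rewrite mulr_sumr; apply: eq_bigr => i _; ring.
  apply: (@le_trans _ _ (2 * (D ^+ 2 * q * (c2 ^+ 2 * M ^+ 2)) * s ^+ 2)).
    rewrite ler_wpM2r ?sqr_ge0// ler_wpM2l// ler_wpM2l//.
    by rewrite mulr_ge0 ?sqr_ge0.
  (* The target [4 * sigma / r2m] is twice what the root gives, whence the factor 4 between the
     squares. *)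
  have -> : (M * (D * (c2 * (4 * sigma / r2m)) * s)) ^+ 2 =
      4 * (2 * (D ^+ 2 * q * (c2 ^+ 2 * M ^+ 2)) * s ^+ 2).
    rewrite /q; have -> : m%:R = r2m ^+ 2 / 2 :> R by rewrite r2mE; field.
    by field; rewrite gt_eqF.
  rewrite ler_peMl//; last by rewrite ler1n.
  by apply: mulr_ge0; rewrite ?sqr_ge0// !mulr_ge0 ?sqr_ge0.
have T3 : \sum_(1 <= i < n.+1) wt i * gam i / 2 * S <= M * (gamma * (c1 * S)).
  have -> : \sum_(1 <= i < n.+1) wt i * gam i / 2 * S =
      S / 2 * \sum_(1 <= i < n.+1) wt i * gam i.
    by rewrite mulr_sumr; apply: eq_bigr => i _; ring.
  apply: (@le_trans _ _ (S / 2 * (2 * c1 * gamma * M))).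
    by rewrite ler_wpM2l// divr_ge0.
  by rewrite le_eqVlt; apply/orP; left; apply/eqP; field.
have T4 : Num.sqrt (2 * (\sum_(1 <= i < n.+1) (wt i * gam i * lam i / 2) ^+ 2 *
  S)
    * s ^+ 2) <= M * (gamma * (kappa * (beta * s) * Num.sqrt S)).
  have Y0 : 0 <= M * (gamma * (kappa * (beta * s) * Num.sqrt S)).
    by rewrite !mulr_ge0 ?sqrtr_ge0 ?(ltW b0) ?(ltW s0) ?(ltW g0).
  rewrite -[leRHS](ger0_norm Y0) -sqrtr_sqr ler_wsqrtr//.
  have -> : \sum_(1 <= i < n.+1) (wt i * gam i * lam i / 2) ^+ 2 * S =
      S / 4 * \sum_(1 <= i < n.+1) (wt i * gam i * lam i) ^+ 2.
    by rewrite mulr_sumr; apply: eq_bigr => i _; field.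
  (* The 2 of the Bernstein radicand, the 1/4 from halving and the 2 of the last hypothesis cancel,
     so that [kappa] enters with coefficient 1. *)
  apply: (@le_trans _ _ (2 * (S / 4 * (2 * (gamma * beta * kappa * M) ^+ 2)) *
    s ^+ 2)).
    by rewrite ler_wpM2r ?sqr_ge0// ler_wpM2l// ler_wpM2l// divr_ge0.
  have -> : (M * (gamma * (kappa * (beta * s) * Num.sqrt S))) ^+ 2 =
      (M * (gamma * (kappa * (beta * s)))) ^+ 2 * Num.sqrt S ^+ 2 by ring.
  by rewrite (sqr_sqrtr S0) le_eqVlt; apply/orP; left; apply/eqP; field.
have T5 : M / gamma * (D ^+ 2 / 2) = M * (D ^+ 2 / (2 * gamma)).
  by field; rewrite gt_eqF.
(* The scale terms of the two sums add up to [D * beta * M * s ^+ 2]; the target allows 4/3 of it,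
   and [T6] disposes of the surplus. *)
have T6 : 0 <= D * beta * M * s ^+ 2.
  by apply: mulr_ge0; rewrite ?sqr_ge0// !mulr_ge0 ?(ltW b0).
rewrite T5; move: T1 T2 T3 T4.
set A1 := \sum_(1 <= i < n.+1) _; set A2 := Num.sqrt (2 * _ * _).
set A3 := \sum_(1 <= i < n.+1) _; set A4 := Num.sqrt (2 * _ * _).
set Q1 := c3 * _; set Q2 := c2 * _; set r := Num.sqrt S => T1 T2 T3 T4.
have -> : M * (D ^+ 2 / (2 * gamma)
    + gamma * (2 / 3 * (beta * s) ^+ 2 + kappa * (beta * s) * r + c1 * S)
    + D * (4 / 3 * (beta * s) + (1 + 1 / e) * (Q2 + Q1)) * s) =
  M * (D ^+ 2 / (2 * gamma)) + (M * (D * ((1 + 1 / e) * Q1) * s)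
   + M * (D * ((1 + 1 / e) * Q2) * s) + 2 / 3 * (gamma * beta ^+ 2 * M * s ^+
     2))
  + (M * (gamma * (c1 * S)) + M * (gamma * (kappa * (beta * s) * r))
   + 4 / 3 * (D * beta * M * s ^+ 2)) by ring.
have -> : (2 * D * (beta * M) / 3 + gamma * beta ^+ 2 * M / 3) * s ^+ 2 =
  2 / 3 * (D * beta * M * s ^+ 2) + 1 / 3 * (gamma * beta ^+ 2 * M * s ^+ 2).
  by field.
have -> : (D * (beta * M) / 3 + gamma * beta ^+ 2 * M / 3) * s ^+ 2 =
  1 / 3 * (D * beta * M * s ^+ 2) + 1 / 3 * (gamma * beta ^+ 2 * M * s ^+ 2).
  by field.
lra.
Qed.

(** * Power sums under the thresholds *)

Section Exponents.
Context {R : realType}.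
Implicit Types (p q r : R) (i k : nat).

Lemma powR_sqrt i q : (0 < i)%N -> i%:R `^ q * Num.sqrt i%:R = i%:R `^ (q + 1 /
  2) :> R.
Proof.
move=> i0; rewrite -powR12_sqrt// -powRD ?pnatr_eq0 -?lt0n ?i0 ?implybT//.
by rewrite div1r.
Qed.

Lemma powR_nat_add1 i q : (0 < i)%N -> i%:R `^ q * i%:R = i%:R `^ (q + 1) :> R.
Proof.
by move=> i0; rewrite powRD ?pnatr_eq0 -?lt0n ?i0 ?implybT// powRr1.
Qed.

Lemma powR_sqr_exp (x : R) q : x `^ q ^+ 2 = x `^ (2 * q).
Proof. by rewrite -powR_mulrn ?powR_ge0// -powRrM mulrC. Qed.

Lemma sqrt_gt0_nat i : (0 < i)%N -> 0 < Num.sqrt i%:R :> R.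
Proof. by move=> i0; rewrite sqrtr_gt0 ltr0n. Qed.

Lemma powR_nat_mono i k q : 0 <= q -> (i <= k)%N -> i%:R `^ q <= k%:R `^ q :> R.
Proof. by move=> q0 ik; rewrite ge0_ler_powR ?nnegrE ?ler0n ?ler_nat. Qed.

Lemma powR_nat_le1 i q : (0 < i)%N -> q <= 0 -> i%:R `^ q <= 1 :> R.
Proof.
move=> i0 q0; have i1 : 1 <= i%:R :> R by rewrite ler1n.
by have := ler_powR i1 q0; rewrite powRr0.
Qed.

(** With [r] the ratio of the minimal clipping level to [beta], it yields r^2 <= k in all cases, r
    <= k^(p + 1/2) for [p < 0], and r^2 <= sqrt k for [p = 0], where a logarithm has to be
    absorbed. *)
Definition threshold p r : R :=
  if p == 0 then r ^+ 4 else r `^ Num.max (2 / (2 * p + 1)) 2.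

Lemma threshold_sqr p r k : - (1 / 2) < p -> 0 <= r -> (0 < k)%N ->
  threshold p r <= k%:R -> r ^+ 2 <= k%:R.
Proof.
move=> p_gt r0 k0; rewrite /threshold.
have k1 : 1 <= k%:R :> R by rewrite ler1n.
have [r1|r1] := leP r 1.
  by move=> _; apply: le_trans k1; rewrite exprn_ile1.
case: ifPn => [_|pn0]; apply: le_trans.
  by rewrite ler_weXn2l// ltW.
by rewrite -powR_mulrn// ler_powR ?(ltW r1)// le_max lexx orbT.
Qed.

Lemma threshold_neg p r k : - (1 / 2) < p -> p < 0 -> 0 <= r ->
  threshold p r <= k%:R -> r <= k%:R `^ (p + 1 / 2).
Proof.
move=> p_gt p0 r0; rewrite /threshold lt_eqF//.
have h : 0 < 2 * p + 1 by lra.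
rewrite max_l; last by rewrite ler_pdivlMr//; lra.
move=> hk; have : (r `^ (2 / (2 * p + 1))) `^ (p + 1 / 2) <= k%:R `^ (p + 1 /
  2).
  by rewrite ge0_ler_powR ?nnegrE ?powR_ge0//; lra.
rewrite -powRrM.
have -> : 2 / (2 * p + 1) * (p + 1 / 2) = 1 by field; lra.
by rewrite powRr1.
Qed.

(** Uniform bound on w_i lambda_i, the size of the summands. For [p < 0] the power of [i] is largest
    at [i = 1], which calls for r <= k^(p + 1/2); otherwise both factors are monotone in [i] and r^2
    <= k suffices. *)
Lemma powR_max_le p (b r : R) i k : - (1 / 2) < p -> 0 < b -> 0 <= r ->
  (0 < i <= k)%N -> r ^+ 2 <= k%:R -> (p < 0 -> r <= k%:R `^ (p + 1 / 2)) ->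
  i%:R `^ p * Num.max (b * Num.sqrt i%:R) (b * r) <= b * k%:R `^ (p + 1 / 2).
Proof.
move=> p_gt b0 r0 /andP[i0 ik] hr hrp.
have k0 : (0 < k)%N by exact: leq_trans ik.
rewrite -maxr_pMr ?(ltW b0)// mulrCA ler_pM2l// maxr_pMr ?powR_ge0//.
rewrite powR_sqrt// ge_max powR_nat_mono//=; last by lra.
have [p0|p0] := ltP p 0.
  apply: le_trans (hrp p0); rewrite ler_piMl// powR_nat_le1//; exact: ltW.
rewrite -powR_sqrt// ler_pM ?powR_ge0// ?powR_nat_mono//.
by rewrite -(ger0_norm r0) -sqrtr_sqr ler_wsqrtr.
Qed.

(** Up to a constant this is the sum of (w_i gamma_i lambda_i)^2, and the origin of [a_coef]. For
    [p < 0] the maximum is bounded by the sum, giving [A + B], at most the square of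
    [Num.sqrt A + Num.sqrt B]; for [p > 0] the maximum is at most [k]; for [p = 0] the harmonic sum
    is compensated by r^2 <= sqrt k. *)
Lemma sum_powR_max_le p r k : - (1 / 2) < p -> 0 <= r -> (0 < k)%N ->
  threshold p r <= k%:R ->
  \sum_(1 <= i < k.+1) i%:R `^ (2 * p - 1) * Num.max i%:R (r ^+ 2) <=
  a_coef p ^+ 2 * k%:R `^ (2 * p + 1).
Proof.
move=> p_gt r0 k0 hk; have hr := threshold_sqr p_gt r0 k0 hk.
have kE q : k%:R `^ (q + 1) = k%:R * k%:R `^ q :> R by rewrite -powR_nat_add1//
  mulrC.
rewrite /a_coef; have [p0|p0|p0] := ltgtP p 0.
- set A := 1 - 1 / (2 * p); set B := 1 / Num.min (2 * p + 1) 1.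
  have A0 : 0 <= A.
    by rewrite subr_ge0 div1r; apply: (@le_trans _ _ 0) => //; rewrite
      invr_le0; lra.
  have B0 : 0 <= B.
    by rewrite divr_ge0// le_min ler01 andbT; lra.
  have hrp : r ^+ 2 <= k%:R `^ (2 * p + 1).
    have := threshold_neg p_gt p0 r0 hk.
    have -> : 2 * p + 1 = 2 * (p + 1 / 2) by field.
    by rewrite -powR_sqr_exp => h; rewrite lerXn2r ?nnegrE ?powR_ge0.
  have s1 : \sum_(1 <= i < k.+1) i%:R `^ (2 * p) <= B * k%:R `^ (2 * p + 1).
    by rewrite /B div1r [leRHS]mulrC; apply: sum_powR_le; lra.
  have s2 : \sum_(1 <= i < k.+1) i%:R `^ (2 * p - 1) <= A.
    by apply: sum_powR_lt_cvg; lra.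
  apply: (@le_trans _ _ (\sum_(1 <= i < k.+1) i%:R `^ (2 * p)
      + r ^+ 2 * \sum_(1 <= i < k.+1) i%:R `^ (2 * p - 1))).
    rewrite mulr_sumr -big_split/= ler_sum_nat// => i /andP[i1 _].
    have -> : i%:R `^ (2 * p) = i%:R `^ (2 * p - 1) * i%:R :> R.
      by rewrite powR_nat_add1// subrK.
    rewrite [r ^+ 2 * _]mulrC -mulrDr ler_wpM2l ?powR_ge0// ge_max.
    by rewrite lerDl sqr_ge0 lerDr ler0n.
  apply: (@le_trans _ _ ((A + B) * k%:R `^ (2 * p + 1))).
    rewrite [leRHS]mulrDl [leRHS]addrC lerD// [leRHS]mulrC.
    by apply: ler_pM => //; rewrite ?sqr_ge0// sumr_ge0// => i _; exact:
      powR_ge0.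
  rewrite ler_wpM2r ?powR_ge0// sqrrD !sqr_sqrtr//.
  by rewrite [leRHS]addrAC lerDl mulrn_wge0// mulr_ge0 ?sqrtr_ge0.
- set m := Num.min (2 * p) 1.
  have m0 : 0 < m by rewrite lt_min ltr01 andbT mulr_gt0.
  rewrite sqr_sqrtr ?divr_ge0 ?(ltW m0)//.
  apply: (@le_trans _ _ (k%:R * \sum_(1 <= i < k.+1) i%:R `^ (2 * p - 1))).
    rewrite mulr_sumr ler_sum_nat// => i /andP[i1 ik].
    by rewrite mulrC ler_wpM2r ?powR_ge0// ge_max hr andbT ler_nat -ltnS.
  have h : \sum_(1 <= i < k.+1) i%:R `^ (2 * p - 1) <= k%:R `^ (2 * p) / m.
    by have := @sum_powR_le R (2 * p - 1) k; rewrite subrK; apply; lra.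
  apply: (le_trans (ler_wpM2l (ler0n _ k) h)); rewrite mulrA -kE.
  have Q0 : 0 <= k%:R `^ (2 * p + 1) / m by rewrite divr_ge0 ?powR_ge0// ltW.
  by rewrite mulrAC; rewrite -mulrA; lra.
- rewrite p0 mulr0 sub0r add0r powRr1//.
  have r2 : r ^+ 2 <= Num.sqrt k%:R.
    rewrite -(ger0_norm (sqr_ge0 r)) -sqrtr_sqr ler_wsqrtr//.
    by move: hk; rewrite /threshold p0 eqxx -exprM.
  set s := Num.sqrt k%:R in r2 *.
  have s0 : 0 < s by exact: sqrt_gt0_nat.
  have s2 : s ^+ 2 = k%:R by rewrite sqr_sqrtr.
  (* The logarithm of [k] is twice that of [s], hence at most [2 * (s - 1)]. *)
  have lnk : 1 + ln k%:R <= 2 * s - 1.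
    rewrite -s2 lnXn// mulr_natl.
    have : ln (1 + (s - 1)) <= s - 1 by apply: le_ln1Dx; lra.
    by rewrite addrC subrK; lra.
  apply: (@le_trans _ _ (\sum_(1 <= i < k.+1) (1 + r ^+ 2 * i%:R^-1))).
    rewrite ler_sum_nat// => i /andP[i1 _]; rewrite powR_inv1//.
    have i0 : 0 < i%:R :> R by rewrite ltr0n.
    rewrite mulrC ler_pdivrMr// mulrDl mul1r divfK ?gt_eqF// ge_max.
    by rewrite lerDl sqr_ge0 lerDr ltW.
  rewrite big_split/= -mulr_sumr sumr_const_nat subn1/=.
  have hs := sum_inv_le R k0.
  have h1 : r ^+ 2 * \sum_(1 <= i < k.+1) (i%:R : R)^-1 <= s * (2 * s - 1).
    apply: ler_pM => //; rewrite ?sqr_ge0// ?(le_trans hs)//.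
    by rewrite sumr_ge0// => i _; rewrite invr_ge0.
  apply: (le_trans (lerD (lexx _) h1)).
  by rewrite -s2; have := sqr_ge0 s => ?; lra.
Qed.

End Exponents.

Theorem corollary1 (R : realType)
  (* the Hilbert space, the feasible set and the objective *)
  (H : completeNormedModType R) (dot : {dot H for idfun})
  (dot_norm : forall x : H, dot x x = `|x| ^+ 2)
  (X : set H) (X_nonempty : X !=set0) (X_closed : closed X)
  (X_convex : convex_set X) (X_bounded : bounded_set X)
  (f : H -> R) (f_convex : convex_function [set: H] f)
  (L : R) (L_gt0 : 0 < L) (f_lipschitz : L.-lipschitz (f : H -> R^o))
  (* the stochastic subgradient *)
  (d : measure_display) (Omega : measurableType d) (P : probability Omega R)
  (dZ : measure_display) (Z : measurableType dZ) (xi : {RV P >-> Z})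
  (u : H -> Z -> H) (sigma : R) (sigma_ge0 : 0 <= sigma)
  (u_subgradient : stochastic_subgradient dot X f u xi sigma)
  (* the batches and the initial point *)
  (m : nat) (m_gt0 : (0 < m)%N)
  (xi_ : nat -> 'I_m -> {RV P >-> Z}) (xi_iid : iid_copies xi xi_)
  (x1 : H) (x1_in_X : X x1)
  (* the parameters *)
  (delta betabar gamma epsilon p : R)
  (delta_gt0 : 0 < delta) (delta_le : delta <= 2 / expR 1)
  (betabar_gt0 : 0 < betabar) (gamma_gt0 : 0 < gamma)
  (epsilon_gt0 : 0 < epsilon) (p_gt : - (1 / 2) < p) :
  let D := diameter X in
  let beta := betabar / Num.sqrt (ln (2 / delta)) in
  let Leps := (1 + epsilon) * L in
  let wt := fun i : nat => i%:R `^ p in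
  let lam := fun i : nat => Num.max (beta * Num.sqrt i%:R) Leps in
  let xbar := fun (gam : nat -> R) (k : nat) =>
    weighted_average wt (cssgm X u gam lam x1 xi_) k in
  (forall k : nat, (0 < k)%N ->
     (if p == 0 then (Leps / beta) ^+ 4
      else (Leps / beta) `^ Num.max (2 / (2 * p + 1)) 2) <= k%:R ->
     ((1 - delta)%:E <=
      P [set w | (f (xbar (fun i => gamma / Num.sqrt i%:R) k w) - min_value X f
        <= Num.max (p + 1) 1 / Num.sqrt k%:R *
           (D ^+ 2 / (2 * gamma)
            + gamma * (2 / 3 * betabar ^+ 2
                       + a_coef p * betabar / Num.sqrt 2
                         * Num.sqrt (sigma ^+ 2 / m%:R + L ^+ 2)
                       + (sigma ^+ 2 / m%:R + L ^+ 2)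
                         / (2 * Num.min (p + 1 / 2) 1))
            + D * (4 / 3 * betabar
                   + (1 + 1 / epsilon) *
                     (1 / Num.min (2 * p + 1) 1
                        * (4 * sigma / Num.sqrt (2 * m%:R))
                      + 1 / Num.min (p + 1 / 2) 1
                        * (sigma ^+ 2 / (m%:R * betabar))))
              * Num.sqrt (ln (2 / delta))))%R])%E)
  /\
  (0 <= p -> forall k : nat, (0 < k)%N -> (Leps / beta) ^+ 2 < k%:R ->
     ((1 - delta)%:E <=
      P [set w | (f (xbar (fun _ => gamma / Num.sqrt k%:R) k w) - min_value X f
        <= Num.max (p + 1) 1 / Num.sqrt k%:R *
           (D ^+ 2 / (2 * gamma)
            + gamma * (2 / 3 * betabar ^+ 2
                       + betabar * Num.sqrt (sigma ^+ 2 / m%:R + L ^+ 2)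
                       + (sigma ^+ 2 / m%:R + L ^+ 2) / 2)
            + D * (4 / 3 * betabar
                   + (1 + 1 / epsilon) *
                     (1 / Num.min (2 * p + 1) 1
                        * (4 * sigma / Num.sqrt (2 * m%:R))
                      + 1 / Num.min (p + 1 / 2) 1
                        * (sigma ^+ 2 / (m%:R * betabar))))
              * Num.sqrt (ln (2 / delta))))%R])%E).
Proof.
move=> D beta Leps wt lam xbar.
have fL x y : `|f x - f y| <= L * `|x - y| by exact: (f_lipschitz (x, y)).
have sub z : X z -> exists v, subdifferential dot f z v.
  by move=> /(proj2 u_subgradient)[v [_ ? _]]; exists v.
have [xs xsX [-> xs_min]] := min_value_attained dot_norm X_nonempty X_closed
  X_convex X_bounded fL sub.
set l := ln (2 / delta); set s := Num.sqrt l.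
have delta2 : 0 < delta / 2 by rewrite divr_gt0.
have l0 : 0 < l.
  have : 1 < 2 / delta.
    rewrite ltr_pdivlMr// mul1r; apply: le_lt_trans delta_le _.
    by rewrite ltr_pdivrMr ?expR_gt0// ltr_pMr// expR_gt1.
  by move=> ?; rewrite /l ln_gt0.
have s0 : 0 < s by rewrite sqrtr_gt0.
have s2 : s ^+ 2 = l by rewrite sqr_sqrtr// ltW.
(* Each of the two tail events has probability at most [delta / 2]. *)
have el : 1 - 2 * expR (- l) = 1 - delta.
  by rewrite /l -lnV ?posrE ?divr_gt0// lnK ?posrE ?invr_gt0 ?divr_gt0//
    invf_div;
    field.
have beta0 : 0 < beta by rewrite divr_gt0.
have betaE : beta * s = betabar by rewrite /beta divfK// gt_eqF.
have Leps0 : 0 < Leps by rewrite mulr_gt0// addr_gt0.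
have D0 : 0 <= D by apply: le_trans (diameter_le X_bounded xsX xsX).
set S := sigma ^+ 2 / m%:R + L ^+ 2.
have S0 : 0 <= S by rewrite addr_ge0 ?divr_ge0 ?sqr_ge0.
have wt0 i : (0 < i)%N -> 0 < wt i by move=> i0; rewrite powR_gt0// ltr0n.
have lam_ge i : (1 + epsilon) * L <= lam i by rewrite le_max lexx orbT.
have lam0 i : 0 < lam i by apply: lt_le_trans (lam_ge i).
(* As [lam i] is [beta] times the maximum of the root of [i] and [r], the conditions on [k] are
   comparisons with [r]. *)
pose r := Leps / beta.
have r0 : 0 <= r by rewrite divr_ge0// ltW.
have br : Leps = beta * r by rewrite /r mulrC divfK// gt_eqF.
have max_p : 0 < Num.max (p + 1) 1 by rewrite lt_max ltr01 orbT.
have min1 : 0 < Num.min (2 * p + 1) 1 by rewrite lt_min ltr01 andbT; lra.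
have min2 : 0 < Num.min (p + 1 / 2) 1 by rewrite lt_min ltr01 andbT; lra.
(* Common part of the two settings. The sums are of order k^(p + 1/2); the stepsizes enter through
   [c1] and [kappa], and the hypothesis under [p < 0] is vacuous for the finite horizon. *)
have core (k : nat) (gam : nat -> R) (c1 kappa : R) : (0 < k)%N ->
    r ^+ 2 <= k%:R -> (p < 0 -> r <= k%:R `^ (p + 1 / 2)) ->
    (forall i, (0 < i)%N -> 0 < gam i) ->
    (forall i, (0 < i)%N -> wt i / gam i <= wt i.+1 / gam i.+1) ->
    wt k / gam k = k%:R `^ (p + 1 / 2) / gamma -> 0 <= kappa -> 0 <= c1 ->
    \sum_(1 <= i < k.+1) wt i * gam i <= 2 * c1 * gamma * k%:R `^ (p + 1 / 2) ->
    \sum_(1 <= i < k.+1) (wt i * gam i * lam i) ^+ 2 <=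
      2 * (gamma * beta * kappa * k%:R `^ (p + 1 / 2)) ^+ 2 ->
    ((1 - delta)%:E <= P [set w | (f (xbar gam k w) - f xs <=
      Num.max (p + 1) 1 / Num.sqrt k%:R * (D ^+ 2 / (2 * gamma)
      + gamma * (2 / 3 * betabar ^+ 2 + kappa * betabar * Num.sqrt S + c1 * S)
      + D * (4 / 3 * betabar + (1 + 1 / epsilon) *
         (1 / Num.min (2 * p + 1) 1 * (4 * sigma / Num.sqrt (2 * m%:R))
          + 1 / Num.min (p + 1 / 2) 1 * (sigma ^+ 2 / (m%:R * betabar)))) *
            s))%R])%E.
  move=> k0 rk rkp gam0 mono wgk kap0 c10 hsum hsq.
  set M := k%:R `^ (p + 1 / 2) in rkp wgk hsum hsq *.
  have M0 : 0 < M by rewrite powR_gt0// ltr0n.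
  have wl i : (0 < i <= k)%N -> wt i * lam i <= beta * M.
    by move=> ik; rewrite /lam br powR_max_le.
  have gb2 : 0 < gamma * beta ^+ 2 * M / 3.
    by rewrite divr_gt0// mulr_gt0// mulr_gt0// exprn_gt0.
  have bM : 0 <= beta * M by rewrite mulr_ge0 ?ltW.
  have W0 : 0 < \sum_(1 <= i < k.+1) wt i by exact: sum_wt_gt0.
  set C := Num.max (p + 1) 1 / _ * _.
  have -> : [set w | f (xbar gam k w) - f xs <= C] =
      [set w | (\sum_(1 <= i < k.+1) wt i) * (f (xbar gam k w) - f xs) <=
        (\sum_(1 <= i < k.+1) wt i) * C].
    by apply/seteqP; split => w /=; rewrite ler_pM2l.
  rewrite -el.
  apply: (regret_bound dot_norm X_nonempty X_closed X_convex X_bounded L_gt0 fL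
    u_subgradient m_gt0 xi_iid x1_in_X epsilon_gt0 gam0 lam_ge wt0 xsX
    (l := l) (cA := 2 * D * (beta * M)) (cZ := D * (beta * M))
    (cA' := 2 * D * (beta * M) / 3 + gamma * beta ^+ 2 * M / 3)
    (cZ' := D * (beta * M) / 3 + gamma * beta ^+ 2 * M / 3) k0 l0 mono).
  - by rewrite mulr_ge0// mulr_ge0.
  - by rewrite mulr_ge0.
  - by rewrite ltrDl.
  - by rewrite ltrDl.
  - by move=> i ik; rewrite ler_wpM2l ?wl// mulr_ge0.
  - by move=> i ik; rewrite ler_wpM2l ?wl.
  rewrite wgk -/S -/D -s2.
  have H1 : \sum_(1 <= i < k.+1) wt i / lam i <=
      1 / Num.min (p + 1 / 2) 1 * M / beta.
    apply: (@le_trans _ _ (beta^-1 * \sum_(1 <= i < k.+1) i%:R `^ (p - 1 / 2))).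
      rewrite mulr_sumr ler_sum_nat// => i /andP[i1 _].
      have -> : i%:R `^ (p - 1 / 2) = wt i / Num.sqrt i%:R.
        have -> : wt i = i%:R `^ (p - 1 / 2) * Num.sqrt i%:R.
          by rewrite powR_sqrt// subrK.
        by rewrite mulfK// gt_eqF// sqrt_gt0_nat.
      rewrite mulrCA ler_wpM2l ?powR_ge0// -invfM.
      by rewrite lef_pV2 ?posrE ?(mulr_gt0 beta0 (sqrt_gt0_nat _)) ?lam0// /lam
        le_max lexx.
    rewrite mulrC ler_pM2r ?invr_gt0// [1 / Num.min _ _]div1r [leRHS]mulrC.
    have := @sum_powR_le R (p - 1 / 2) k.
    have -> : p - 1 / 2 + 1 = p + 1 / 2 by field.
    move=> h; apply: h; lra.
  have H2 : \sum_(1 <= i < k.+1) wt i ^+ 2 <=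
      (1 / Num.min (2 * p + 1) 1) ^+ 2 * M ^+ 2.
    under eq_bigr do rewrite powR_sqr_exp.
    apply: (@le_trans _ _ (k%:R `^ (2 * p + 1) / Num.min (2 * p + 1) 1)).
      by apply: sum_powR_le; lra.
    rewrite powR_sqr_exp; have -> : 2 * (p + 1 / 2) = 2 * p + 1 by field.
    (* The minimum is at most 1, so its inverse is at most the square of its inverse. *)
    rewrite mulrC ler_wpM2r ?powR_ge0// div1r expr2 ler_peMl ?invr_ge0 ?(ltW
      min1)//.
    by rewrite invf_ge1// ge_min lexx orbT.
  have hB := regret_bound_le D0 sigma_ge0 epsilon_gt0 beta0 s0 gamma_gt0 (ltW
    M0)
    kap0 (divr_ge0 ler01 (ltW min1)) m_gt0 S0 H1 H2 hsum hsq.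
  apply: (le_trans hB); rewrite betaE /C.
  set bra := (X in M * X).
  have sk : 0 < Num.sqrt k%:R :> R by exact: sqrt_gt0_nat.
  (* Source of the prefactor: the weights sum to at least k^(p + 1) over [Num.max (p + 1) 1], while
     [M] is k^(p + 1/2). *)
  have WM : M <= (\sum_(1 <= i < k.+1) wt i) * (Num.max (p + 1) 1 / Num.sqrt
    k%:R).
    rewrite mulrA ler_pdivlMr// /M powR_sqrt//.
    have -> : p + 1 / 2 + 1 / 2 = p + 1 by field.
    by rewrite -ler_pdivrMr// sum_powR_ge//; lra.
  rewrite mulrA ler_wpM2r// /bra.
  have nn1 : 0 <= D ^+ 2 / (2 * gamma).
    by rewrite divr_ge0 ?sqr_ge0// mulr_ge0// ltW.
  have bb0 := ltW betabar_gt0; have g0 := ltW gamma_gt0.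
  have nn2 : 0 <= 2 / 3 * betabar ^+ 2 + kappa * betabar * Num.sqrt S + c1 * S.
    apply: addr_ge0; last exact: mulr_ge0.
    apply: addr_ge0; first by rewrite mulr_ge0 ?divr_ge0 ?sqr_ge0.
    by rewrite mulr_ge0 ?sqrtr_ge0// mulr_ge0.
  have nn3 : 0 <= 4 / 3 * betabar + (1 + 1 / epsilon) *
      (1 / Num.min (2 * p + 1) 1 * (4 * sigma / Num.sqrt (2 * m%:R)) +
       1 / Num.min (p + 1 / 2) 1 * (sigma ^+ 2 / (m%:R * betabar))).
    apply: addr_ge0; first by rewrite mulr_ge0.
    apply: mulr_ge0; first by rewrite addr_ge0// divr_ge0// ltW.
    apply: addr_ge0; apply: mulr_ge0; rewrite ?divr_ge0 ?sqr_ge0 ?sqrtr_ge0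
      ?(ltW min1) ?(ltW min2)//.
      by rewrite mulr_ge0.
    by rewrite mulr_ge0.
  by rewrite !addr_ge0// mulr_ge0// ?mulr_ge0// ltW.
have sq0 i : (0 < i)%N -> 0 < Num.sqrt i%:R :> R by exact: sqrt_gt0_nat.
have max_sqr (a b : R) : 0 <= a -> 0 <= b -> Num.max a b ^+ 2 = Num.max (a ^+
  2) (b ^+ 2).
  move=> a0 b0; have [ab|ab] := leP a b.
    by rewrite max_r// lerXn2r.
  by rewrite max_l// lerXn2r ?nnegrE// ltW.
split.
  move=> k k0 hk.
  have a0 : 0 <= a_coef p.
    rewrite /a_coef; case: ifP => _; first exact: sqrtr_ge0.
    by case: ifP => _ //; rewrite addr_ge0 ?sqrtr_ge0.
  have thr : threshold p r <= k%:R by [].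
  have := core k (fun i => gamma / Num.sqrt i%:R)
    (1 / (2 * Num.min (p + 1 / 2) 1)) (a_coef p / Num.sqrt 2) k0
    (threshold_sqr p_gt r0 k0 thr) (fun p0 => threshold_neg p_gt p0 r0 thr).
  have wtE i : (0 < i)%N -> wt i / (gamma / Num.sqrt i%:R) =
      i%:R `^ (p + 1 / 2) / gamma.
    by move=> i0; rewrite invf_div mulrA powR_sqrt.
  have wtD i : (0 < i)%N -> wt i / Num.sqrt i%:R = i%:R `^ (p - 1 / 2).
    move=> i0; have -> : wt i = i%:R `^ (p - 1 / 2) * Num.sqrt i%:R.
      by rewrite powR_sqrt// subrK.
    by rewrite mulfK// gt_eqF// sq0.
  rewrite -/s -/S.
  have -> : 1 / (2 * Num.min (p + 1 / 2) 1) * S = S / (2 * Num.min (p + 1 / 2)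
    1).
    by rewrite div1r mulrC.
  have -> : a_coef p / Num.sqrt 2 * betabar * Num.sqrt S =
      a_coef p * betabar / Num.sqrt 2 * Num.sqrt S by ring.
  apply.
  - by move=> i i0; rewrite divr_gt0 ?sq0.
  - move=> i i0; rewrite !wtE// ler_pM2r ?invr_gt0//.
    by apply: powR_nat_mono => //; lra.
  - by rewrite wtE.
  - by rewrite divr_ge0 ?sqrtr_ge0.
  - by rewrite divr_ge0// mulr_ge0// ltW.
  - apply: (@le_trans _ _ (gamma * \sum_(1 <= i < k.+1) i%:R `^ (p - 1 / 2))).
      rewrite mulr_sumr ler_sum_nat// => i /andP[i1 _].
      by rewrite mulrCA wtD.
    have := @sum_powR_le R (p - 1 / 2) k.
    have -> : p - 1 / 2 + 1 = p + 1 / 2 by field.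
    have -> : -1 < p - 1 / 2 by lra.
    move=> /(_ isT) h.
    apply: (le_trans (ler_wpM2l (ltW gamma_gt0) h)).
    rewrite le_eqVlt; apply/orP; left; apply/eqP; field.
    by rewrite gt_eqF.
  apply: (@le_trans _ _ ((gamma * beta) ^+ 2 *
      \sum_(1 <= i < k.+1) i%:R `^ (2 * p - 1) * Num.max i%:R (r ^+ 2))).
    rewrite mulr_sumr ler_sum_nat// => i /andP[i1 _].
    have -> : wt i * (gamma / Num.sqrt i%:R) * lam i =
        (gamma * beta) * (i%:R `^ (p - 1 / 2) * Num.max (Num.sqrt i%:R) r).
      rewrite -wtD// /lam br -maxr_pMr ?(ltW beta0)//; ring.
    rewrite [(gamma * beta * _) ^+ 2]exprMn [(_ `^ _ * _) ^+ 2]exprMn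
      powR_sqr_exp max_sqr ?sqrtr_ge0// sqr_sqrtr//.
    by have -> : 2 * (p - 1 / 2) = 2 * p - 1 by field.
  apply: (le_trans (ler_wpM2l (sqr_ge0 _) (sum_powR_max_le p_gt r0 k0 thr))).
  have -> : 2 * p + 1 = 2 * (p + 1 / 2) by field.
  rewrite -powR_sqr_exp.
  have q2 : Num.sqrt 2 ^+ 2 = 2 :> R by rewrite sqr_sqrtr.
  have q20 : Num.sqrt 2 != 0 :> R by rewrite gt_eqF// sqrtr_gt0.
  (* Dividing [a_coef p] by the root of 2 cancels the factor 2 in the last hypothesis of [core]. *)
  have -> : 2 * (gamma * beta * (a_coef p / Num.sqrt 2) * k%:R `^ (p + 1 / 2))
    ^+ 2
     = 2 * (gamma * beta * a_coef p * k%:R `^ (p + 1 / 2)) ^+ 2 / Num.sqrt 2 ^+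
       2.
    by field.
  by rewrite q2 le_eqVlt; apply/orP; left; apply/eqP; field.
move=> p0 k k0 hk.
have rk : r ^+ 2 <= k%:R by exact: ltW.
have rkp : p < 0 -> r <= k%:R `^ (p + 1 / 2) by rewrite ltNge p0.
have := core k (fun=> gamma / Num.sqrt k%:R) (1 / 2) 1 k0 rk rkp.
rewrite -/s -/S.
have -> : 1 / 2 * S = S / 2 by rewrite div1r mulrC.
have -> : 1 * betabar * Num.sqrt S = betabar * Num.sqrt S by rewrite mul1r.
have kk : k%:R = Num.sqrt k%:R ^+ 2 :> R by rewrite sqr_sqrtr.
apply => //.
- by move=> i i0; rewrite divr_gt0 ?sq0.
- by move=> i i0; rewrite ler_pM2r ?invr_gt0 ?divr_gt0 ?sq0// powR_nat_mono.
- by rewrite invf_div mulrA powR_sqrt.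
- rewrite -mulr_suml.
  have := @sum_powR_le R p k; have -> : -1 < p by lra.
  move=> /(_ isT); rewrite min_r ?divr1; last by lra.
  move=> h; apply: (@le_trans _ _ (k%:R `^ (p + 1) * (gamma / Num.sqrt k%:R))).
    by rewrite ler_wpM2r// divr_ge0 ?sqrtr_ge0// ltW.
  have -> : p + 1 = p + 1 / 2 + 1 / 2 by field.
  rewrite -powR_sqrt// le_eqVlt; apply/orP; left; apply/eqP; field.
  by rewrite gt_eqF// sq0.
(* Each term is bounded through the uniform bound on w_i lambda_i, and the square of 1 / sqrt k
   compensates for the [k] terms; this gives [kappa = 1] with a factor 2 to spare. *)
apply: (@le_trans _ _ (\sum_(1 <= i < k.+1)
    (gamma / Num.sqrt k%:R * (beta * k%:R `^ (p + 1 / 2))) ^+ 2)).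
  rewrite ler_sum_nat// => i ik.
  have -> : wt i * (gamma / Num.sqrt k%:R) * lam i =
      gamma / Num.sqrt k%:R * (wt i * lam i) by ring.
  have g0 : 0 <= gamma / Num.sqrt k%:R by rewrite divr_ge0 ?sqrtr_ge0// ltW.
  have wl0 : 0 <= wt i * lam i by rewrite mulr_ge0 ?powR_ge0// ltW.
  have wl : wt i * lam i <= beta * k%:R `^ (p + 1 / 2).
    by rewrite /lam br powR_max_le.
  have h0 := le_trans wl0 wl.
  by rewrite lerXn2r ?nnegrE ?(mulr_ge0 g0 wl0) ?(mulr_ge0 g0 h0)// ler_wpM2l.
rewrite sumr_const_nat subn1 -[leLHS]mulr_natr [k.+1.-1]/=.
set M := k%:R `^ _.
have -> : (gamma / Num.sqrt k%:R * (beta * M)) ^+ 2 * k%:R = (gamma * beta * M)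
  ^+ 2.
  by rewrite [in X in _ * X]kk; field; rewrite gt_eqF// sq0.
by rewrite mulr1 ler_peMl ?sqr_ge0// ler1n.
Qed.
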